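(* Let $G$ be a connected simple Hermitian symmetric Lie group with finite center. The quasimorphisms $\nu_G$ and $\varrho_G$ (the Guichardet-Wigner quasimorphism) on $\widetilde{G}$ satisfy $\nu_G=-\varrho_{G}$.
   Context: $\widetilde G$ is the universal cover of $G$ (homotopy classes with fixed endpoints of paths starting at $\mathrm{Id}$). $K\subset G$ is the analytic subgroup corresponding to the maximal compact subalgebra; $X=G/K$ is a Hermitian symmetric space of non-compact type, of complex dimension $N$, with $G$-invariant complex structure $j_X$ and Bergman Kähler form $\sigma_X$, normalized by $\mathrm{Ric}(\sigma_X)=-\sigma_X$ (Ricci form $iF$, $F$ being the curvature of the Chern connection on $L_X=\Lambda^N_{\mathbb C}TX$). The quasimorphism $\nu_G$. $G$ acts on $L_X$ by differentials, hence on the unit circle bundle $P_X\to X$ of $L_X$, preserving the real connection one-form $\alpha_X$ of the Chern connection (normalized to equal $1$ on the generator of $\theta\mapsto e^{i\theta}$), which satisfies $d\alpha_X=\widetilde{\sigma_X}$, the pullback of $\sigma_X$. For $\xi\in\mathrm{Lie}(G)$ let $\widehat\xi$ be the vector field on $P_X$ generated by $\xi$; put $\mu_X(\xi)(x)=(\alpha_X)_y(\widehat\xi_y)$ for any $y\in P_X$ over $x$ (an equivariant moment map, $\iota_{\bar\xi}\sigma_X=-d\mu_X(\xi)$, where $\bar\xi$ is the vector field on $X$ generated by $\xi$). For a path $\{g_t\}$ from $\mathrm{Id}$ to $g$ with $\xi_t=\dot g_tg_t^{-1}$ and $x\in X$, put $\nu_x([\{g_t\}])=\int_D\sigma_X-\int_0^1\mu_X(\xi_t)(g_t\cdot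 x)\,dt$, with $D$ any disk bounded by $\{g_t\cdot x\}$ followed by the geodesic from $g\cdot x$ to $x$. Then $\nu_x$ is a quasimorphism and $\nu_G(\widetilde g)=\lim_{k\to\infty}\frac1k\nu_x(\widetilde g^{\,k})$ is a homogeneous quasimorphism independent of $x$. The quasimorphism $\varrho_G$. Let $x_0=[\mathrm{Id}]\in X=G/K$, a fixed point of $K$, and $v:K\to S^1$, $v(k)=\det_{\mathbb C}\big(dk|_{T_{x_0}X}\big)$, the character given by the linearized action of $K$ at $x_0$; let $\widetilde v:\widetilde K\to\mathbb R$ be its lift, i.e. the homomorphism with $v=e^{i\widetilde v}$. The Guichardet-Wigner quasimorphism $\varrho_G:\widetilde G\to\mathbb R$ is the unique homogeneous quasimorphism whose pullback to $\widetilde K$ under the natural map $\widetilde K\to\widetilde G$ equals $\widetilde v$. *)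

(* Defs.v *)
From HB Require Import structures.
From mathcomp Require Import all_boot all_order all_algebra complex.
From mathcomp Require Import all_classical all_reals all_analysis.

Set Implicit Arguments.
Unset Strict Implicit.
Unset Printing Implicit Defensive.

Import Order.TTheory GRing.Theory Num.Theory.
Import numFieldNormedType.Exports.

Local Open Scope classical_set_scope.
Local Open Scope ring_scope.
Local Open Scope complex_scope.

(** * Smooth maps between (finite-dimensional) normed spaces *)

Fixpoint Ck {R : realType} (k : nat) {V W : normedModType R}
    (U : set V) (f : V -> W) : Prop :=
  match k with
  | 0 => forall x, U x -> {for x, continuous f}
  | k'.+1 => (forall x, U x -> differentiable f x) /\
             (forall v, Ck k' U (fun x => 'D_v f x))
  end.

Definition smooth_on {R : realType} {V W : normedModType R}
  (U : set V) (f : V -> W) : Prop := forall k, Ck k U f.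

(** * Smooth manifolds *)

Record chart (R : realType) (M : topologicalType) (E : normedModType R) :=
  Chart { dom : set M; coord :> M -> E; param : E -> M }.

Definition im {R : realType} {M : topologicalType} {E : normedModType R}
  (c : chart M E) : set E := c @` dom c.

Definition is_chart {R : realType} {M : topologicalType} {E : normedModType R}
    (c : chart M E) : Prop :=
  [/\ open (dom c), open (im c),
      forall x, dom c x -> param c (c x) = x,
      forall x, dom c x -> {for x, continuous c} &
      forall z, im c z -> {for z, continuous (param c)}].

(* [chart_at x] is a preferred chart around [x].  The tangent space at [x] is
   modelled by [E]: a tangent vector is given by its coordinates in
   [chart_at x]. *)
Record manifold (R : realType) (M : topologicalType) (E : normedModType R) :=
  Manifold {
    atlas : set (chart M E);
    chart_at : M -> chart M E;
    atlas_is_chart : forall c, atlas c -> is_chart c;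
    chart_at_atlas : forall x, atlas (chart_at x);
    chart_at_dom : forall x, dom (chart_at x) x;
    atlas_smooth : forall c d, atlas c -> atlas d ->
      smooth_on (c @` (dom c `&` dom d)) (d \o param c);
    manifold_hausdorff : hausdorff_space M;
    manifold_second_countable : @second_countable M }.

Section Maps.
Context {R : realType}.

Definition smooth_into {V E : normedModType R} {M : topologicalType}
    (A : manifold M E) (f : V -> M) : Prop :=
  continuous f /\
  forall c, atlas A c -> smooth_on (f @^-1` dom c) (c \o f).

Definition smooth_map {E E' : normedModType R} {M M' : topologicalType}
    (A : manifold M E) (A' : manifold M' E') (f : M -> M') : Prop :=
  continuous f /\
  forall c d, atlas A c -> atlas A' d ->
    smooth_on (c @` (dom c `&` f @^-1` dom d)) (d \o f \o param c).

(* Smoothness on the product manifold, read in product charts. *)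
Definition smooth_map2 {E1 E2 E' : normedModType R}
    {M1 M2 M' : topologicalType} (A1 : manifold M1 E1) (A2 : manifold M2 E2)
    (A' : manifold M' E') (f : M1 -> M2 -> M') : Prop :=
  continuous (fun xy : M1 * M2 => f xy.1 xy.2) /\
  forall c1 c2 d, atlas A1 c1 -> atlas A2 c2 -> atlas A' d ->
    smooth_on
      [set z : E1 * E2 | [/\ im c1 z.1, im c2 z.2 &
                             dom d (f (param c1 z.1) (param c2 z.2))]]
      (fun z => d (f (param c1 z.1) (param c2 z.2))).

Definition tmap {E E' : normedModType R} {M M' : topologicalType}
    (A : manifold M E) (A' : manifold M' E') (f : M -> M') (x : M) (u : E) :
    E' :=
  'D_u (chart_at A' (f x) \o f \o param (chart_at A x)) (chart_at A x x).

Definition velocity {E : normedModType R} {M : topologicalType}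
    (A : manifold M E) (p : R -> M) (t : R) : E :=
  derive1 (fun s => chart_at A (p t) (p s)) t.

Definition unit_itv : set R := [set t | 0 <= t <= 1].

End Maps.

(** * Lie groups *)

#[short(type="topGroupType")]
HB.structure Definition TopGroup := {G of Topological G & Group G}.

Section LieGroup.
Context {R : realType} {n : nat} {G : topGroupType}.
Variable GM : manifold G 'rV[R]_n.

(* The Lie algebra is the tangent space at 1, i.e. ['rV[R]_n]. *)
Let e := chart_at GM 1%g.
Let o := e 1%g.

Definition is_lie_group : Prop :=
  smooth_map2 GM GM GM (fun g h => (g * h)%g) /\
  smooth_map GM GM (fun g => g^-1%g).

(* The second-order part of the product in a chart is a bilinear map B, and
   [u, v] = B(u, v) - B(v, u). *)
Definition lie_bracket (u v : 'rV[R]_n) : 'rV[R]_n :=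
  'D_u (fun z => 'D_v (fun w => e (param e z * param e w)%g) o) o -
  'D_u (fun z => 'D_v (fun w => e (param e w * param e z)%g) o) o.

Definition simple_lie_algebra : Prop :=
  (exists u v, lie_bracket u v != 0) /\
  forall I : {vspace 'rV[R]_n},
    (forall u v, v \in I -> lie_bracket u v \in I) ->
    I = 0%VS \/ I = fullv.

Definition Ad (g : G) (u : 'rV[R]_n) : 'rV[R]_n :=
  tmap GM GM (fun h => (g * h * g^-1)%g) 1%g u.

Definition Ad_mx (g : G) : 'M[R]_n := lin1_mx (Ad g).

Definition one_parameter_subgroup (phi : R -> G) : Prop :=
  smooth_into GM phi /\ forall s t, phi (s + t) = (phi s * phi t)%g.

Definition is_subgroup (H : set G) : Prop :=
  [/\ H 1%g, forall g h, H g -> H h -> H (g * h)%g &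
      forall g, H g -> H g^-1%g].

(* The subgroup generated by exp(h). *)
Definition analytic_subgroup (h : {vspace 'rV[R]_n}) : set G :=
  [set g | forall H : set G, is_subgroup H ->
     (forall phi, one_parameter_subgroup phi -> velocity GM phi 0 \in h ->
        forall t, H (phi t)) ->
     H g].

Definition is_subalgebra (h : {vspace 'rV[R]_n}) : Prop :=
  forall u v, u \in h -> v \in h -> lie_bracket u v \in h.

(* [h] is compactly embedded: the analytic subgroup of Int(Lie G) with Lie
   algebra ad(h) is relatively compact. *)
Definition compact_subalgebra (h : {vspace 'rV[R]_n}) : Prop :=
  is_subalgebra h /\ compact (closure (Ad_mx @` analytic_subgroup h)).

Definition maximal_compact_subalgebra (k : {vspace 'rV[R]_n}) : Prop :=
  compact_subalgebra k /\
  forall h, compact_subalgebra h -> (k <= h)%VS -> h = k.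

Definition group_center : set G := [set z | forall g, (z * g = g * z)%g].

Record connected_simple_lie_group : Prop := {
  csl_lie_group : is_lie_group;
  csl_connected : connected [set: G];
  csl_simple : simple_lie_algebra;
  csl_center : finite_set group_center }.

(* dp/dt p(t)^{-1} *)
Definition log_velocity (p : R -> G) (t : R) : 'rV[R]_n :=
  velocity GM (fun s => (p s * (p t)^-1)%g) t.

(** * Universal cover *)

(* For a subgroup [A] of [G] with the subspace topology, the universal cover of
   [A] is [ucover A]: its elements are homotopy classes (as sets) of smooth
   paths, parametrized by [0, 1] (values outside of [0, 1] are irrelevant),
   starting at 1 and lying in [A]. *)
Definition smooth_path (A : set G) (p : R -> G) : Prop :=
  [/\ smooth_into GM p, p 0 = 1%g & forall t, unit_itv t -> A (p t)].

Definition homotopic (A : set G) (p q : R -> G) : Prop :=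
  exists H : R * R -> G,
    {within unit_itv `*` unit_itv, continuous H} /\
    forall t, unit_itv t ->
      [/\ forall s, unit_itv s -> A (H (t, s)),
          H (t, 0) = p t, H (t, 1) = q t, H (0, t) = 1%g & H (1, t) = p 1].

Definition path_class (A : set G) (p : R -> G) : set (R -> G) :=
  [set q | smooth_path A q /\ homotopic A p q].

Definition ucover (A : set G) : set (set (R -> G)) :=
  [set a | exists2 p, smooth_path A p & a = path_class A p].

(* [p] * [q] = [p * q] (pointwise product). *)
Definition ucover_mul (A : set G) (a b : set (R -> G)) : set (R -> G) :=
  [set r | exists p q, [/\ a p, b q &
                           path_class A (fun t => (p t * q t)%g) r]].

Definition ucover_exp (A : set G) (a : set (R -> G)) (k : nat) :
    set (R -> G) :=
  iter k (ucover_mul A a) (path_class A (fun=> 1%g)).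

(* The map from [ucover A] to [ucover setT] induced by the inclusion. *)
Definition ucover_map (a : set (R -> G)) : set (R -> G) :=
  [set r | exists2 p, a p & path_class [set: G] p r].

(* Real functions on the universal cover of [G] are functions on sets of paths,
   of which only the values on [ucover setT] matter. *)
Definition quasimorphism (f : set (R -> G) -> R) : Prop :=
  exists C : R, forall a b, ucover setT a -> ucover setT b ->
    `|f (ucover_mul setT a b) - f a - f b| <= C.

Definition homogeneous_quasimorphism (f : set (R -> G) -> R) : Prop :=
  quasimorphism f /\
  forall a k, ucover setT a -> f (ucover_exp setT a k) = f a *+ k.

End LieGroup.

(** * Complex coordinates *)

(* C^N is identified with R^N x R^N by (x, y) |-> x + i y. *)
Notation Cspace R N := ('rV[R]_N * 'rV[R]_N)%type (only parsing).

Section ComplexCoordinates.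
Context {R : realType} {N : nat}.
Notation V := (Cspace R N).

Definition Jmul (u : V) : V := (- u.2, u.1).

Definition cbasis (j : 'I_N) : V := (delta_mx 0 j, 0).

Definition detC (f : V -> V) : R[i] :=
  \det (\matrix_(j < N, l < N)
          ((f (cbasis j)).1 0 l +i* (f (cbasis j)).2 0 l)).

Definition derC {W : normedModType R} (u : W) (f : W -> R[i]) (z : W) : R[i] :=
  'D_u (fun w => complex.Re (f w)) z +i* 'D_u (fun w => complex.Im (f w)) z.

Definition is_complex_manifold {X : topologicalType} (XM : manifold X V) :
    Prop :=
  forall c d, atlas XM c -> atlas XM d ->
  forall z u, (c @` (dom c `&` dom d)) z ->
    'D_(Jmul u) (d \o param c) z = Jmul ('D_u (d \o param c) z).

End ComplexCoordinates.

(** * Kähler forms and the anticanonical bundle *)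

Section Kahler.
Context {R : realType} {N : nat} {X : topologicalType}.
Notation V := (Cspace R N).
Variable XM : manifold X V.

(* A 2-form is a family of bilinear forms on the tangent spaces, a tangent
   vector at [x] being given in [chart_at x]. *)
Variable sigma : X -> V -> V -> R.

(* The form in the coordinates of an arbitrary chart. *)
Definition form_in (c : chart X V) (z u v : V) : R :=
  let x := param c z in
  sigma x ('D_u (chart_at XM x \o param c) z)
          ('D_v (chart_at XM x \o param c) z).

Definition metric_in (c : chart X V) (z u v : V) : R := form_in c z u (Jmul v).

Record is_kahler_form : Prop := {
  kahler_linear : forall x a u v w,
    sigma x (a *: u + v) w = a * sigma x u w + sigma x v w;
  kahler_antisym : forall x u v, sigma x u v = - sigma x v u;
  kahler_smooth : forall c u v, atlas XM c ->
    smooth_on (im c) (fun z => form_in c z u v);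
  kahler_closed : forall c z u v w, atlas XM c -> im c z ->
    'D_u (fun y => form_in c y v w) z + 'D_v (fun y => form_in c y w u) z +
    'D_w (fun y => form_in c y u v) z = 0;
  kahler_J : forall x u v, sigma x (Jmul u) (Jmul v) = sigma x u v;
  kahler_pos : forall x u, u != 0 -> 0 < sigma x u (Jmul u) }.

(* The Hermitian metric (linear in [u]) with real part the Riemannian metric. *)
Definition hermitian_in (c : chart X V) (z u v : V) : R[i] :=
  metric_in c z u v -i* form_in c z u v.

(* Squared norm of the frame d/dz_1 /\ ... /\ d/dz_N of L_X given by the
   chart [c]. *)
Definition frame_norm2 (c : chart X V) (z : V) : R :=
  complex.Re (\det (\matrix_(j < N, l < N)
                      hermitian_in c z (cbasis j) (cbasis l))).

(* Connection form of the Chern connection of L_X in that holomorphic frame: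
   the (1,0)-part of d log |frame|^2. *)
Definition chern_form (c : chart X V) (z u : V) : R[i] :=
  let f w := ln (frame_norm2 c w) in
  ('D_u f z / 2) -i* ('D_(Jmul u) f z / 2).

Definition chern_curvature (c : chart X V) (z u v : V) : R[i] :=
  derC u (fun w => chern_form c w v) z - derC v (fun w => chern_form c w u) z.

Definition ricci_form (c : chart X V) (z u v : V) : R[i] :=
  (0 +i* 1) * chern_curvature c z u v.

Definition ricci_normalized : Prop :=
  forall c z u v, atlas XM c -> im c z ->
    ricci_form c z u v = (- form_in c z u v)%:C.

(* Geodesic equation on [0, 1], with the index of the acceleration lowered by
   the metric g: d/dt g(p', w) = (d_w g)(p', p') / 2 for every vector w which is
   constant in the chart. *)
Definition is_geodesic (p : R -> X) : Prop :=
  forall t w, unit_itv t ->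
    let c := chart_at XM (p t) in
    let dp s := derive1 (fun r => c (p r)) s in
    derive1 (fun s => metric_in c (c (p s)) (dp s) w) t =
    'D_w (fun z => metric_in c z (dp t) (dp t)) (c (p t)) / 2.

(* The integral of [sigma] on the singular square [D]. *)
Definition square_area (D : R * R -> X) : R :=
  \int[lebesgue_measure]_(t in `[0, 1])
    \int[lebesgue_measure]_(s in `[0, 1])
      sigma (D (t, s)) (velocity XM (fun r => D (r, s)) t)
                       (velocity XM (fun r => D (t, r)) s).

(* The total space of L_X is [X * R[i]]: the point (x, s) is s times the frame
   at x given by [chart_at x]; [frame_coord c] is the fibre coordinate in the
   frame given by another chart [c].  A tangent vector of L_X at (x, s) is
   a pair (u, a), in the trivialization over [chart_at x]. *)
Definition frame_coord (c : chart X V) (y : X * R[i]) : R[i] :=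
  let d := chart_at XM y.1 in
  detC (fun u => 'D_u (c \o param d) (d y.1)) * y.2.

Definition circle_bundle : set (X * R[i]) :=
  [set y | (complex.Re y.2 ^+ 2 + complex.Im y.2 ^+ 2) *
           frame_norm2 (chart_at XM y.1) (chart_at XM y.1 y.1) = 1].

(* alpha_X = (ds / s + chern_form) / i; on tangent vectors of the circle bundle
   the real part of ds / s + chern_form is 0. *)
Definition alpha_form (y : X * R[i]) (w : V * R[i]) : R :=
  complex.Im (w.2 / y.2 +
    chern_form (chart_at XM y.1) (chart_at XM y.1 y.1) w.1).

Definition unit_over (x : X) : X * R[i] :=
  xget (x, 1) [set y | circle_bundle y /\ y.1 = x].

End Kahler.

(** * The symmetric space and the quasimorphisms *)

Section Hermitian.
Context {R : realType} {n N : nat} {G : topGroupType} {X : topologicalType}.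
Notation V := (Cspace R N).
Variables (GM : manifold G 'rV[R]_n) (XM : manifold X V).
Variable act : G -> X -> X.

(* [X] is G/K, with a G-invariant complex structure. *)
Record is_complex_homogeneous_space (K : set G) (x0 : X) : Prop := {
  chs_complex : is_complex_manifold XM;
  chs_act1 : forall x, act 1%g x = x;
  chs_actM : forall g h x, act (g * h)%g x = act g (act h x);
  chs_smooth : smooth_map2 GM XM XM act;
  chs_holomorphic : forall g x u,
    tmap XM XM (act g) x (Jmul u) = Jmul (tmap XM XM (act g) x u);
  chs_transitive : forall x, exists g, x = act g x0;
  chs_stabilizer : forall g, act g x0 = x0 <-> K g }.

Variable sigma : X -> V -> V -> R.

(* On an irreducible symmetric space the invariant Kähler forms are the positive
   multiples of the Bergman form, and Ric does not change under rescaling: so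
   the normalization Ric = - sigma leaves exactly one form. *)
Record is_bergman_form : Prop := {
  bergman_kahler : is_kahler_form XM sigma;
  bergman_invariant : forall g x u v,
    sigma (act g x) (tmap XM XM (act g) x u) (tmap XM XM (act g) x v) =
    sigma x u v;
  bergman_ricci : ricci_normalized XM sigma }.

Definition act_L (g : G) (y : X * R[i]) : X * R[i] :=
  (act g y.1, detC (tmap XM XM (act g) y.1) * y.2).

(* The vector field generated by [xi] on L_X. *)
Definition generated_field (xi : 'rV[R]_n) (y : X * R[i]) : V * R[i] :=
  let e := chart_at GM 1%g in
  (tmap GM XM (fun g => act g y.1) 1%g xi,
   derC xi (fun z => frame_coord XM (chart_at XM y.1) (act_L (param e z) y))
     (e 1%g)).

Definition moment (xi : 'rV[R]_n) (x : X) : R :=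
  alpha_form XM sigma (unit_over XM sigma x)
    (generated_field xi (unit_over XM sigma x)).

(* A disk, parametrized by the square [0, 1] x [0, 1], whose oriented boundary
   is the path p(t).x followed by the geodesic from p(1).x to x (the top side,
   run backwards); the vertical sides are constant. *)
Definition is_filling_disk (D : R * R -> X) (p : R -> G) (x : X) : Prop :=
  [/\ smooth_into XM D,
      forall t, unit_itv t -> D (t, 0) = act (p t) x,
      forall s, unit_itv s -> D (0, s) = x /\ D (1, s) = act (p 1) x &
      is_geodesic XM sigma (fun t => D (t, 1))].

Definition is_nu (nu : X -> set (R -> G) -> R) : Prop :=
  forall x p D, smooth_path GM setT p -> is_filling_disk D p x ->
    nu x (path_class GM setT p) =
    square_area XM sigma D -
    \int[lebesgue_measure]_(t in `[0, 1])
      moment (log_velocity GM p t) (act (p t) x).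

(* The homogenization of every nu_x; it does not depend on x. *)
Definition is_nuG (nu : X -> set (R -> G) -> R) (nuG : set (R -> G) -> R) :
    Prop :=
  forall x a, ucover GM setT a ->
    (fun k : nat => nu x (ucover_exp GM setT a k) / k%:R) @ \oo --> nuG a.

Definition isotropy_character (x0 : X) (k : G) : R[i] :=
  detC (tmap XM XM (act k) x0).

(* The continuity of the lift is expressed along the paths
   t |-> [s |-> p(ts)]. *)
Record is_lift (K : set G) (v : G -> R[i]) (vt : set (R -> G) -> R) : Prop := {
  lift_mul : forall a b, ucover GM K a -> ucover GM K b ->
    vt (ucover_mul GM K a b) = vt a + vt b;
  lift_exp : forall p, smooth_path GM K p ->
    v (p 1) = cos (vt (path_class GM K p)) +i* sin (vt (path_class GM K p));
  lift_continuous : forall p, smooth_path GM K p ->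
    {within unit_itv,
      continuous (fun t : R => vt (path_class GM K (fun s => p (t * s))))} }.

Definition extends_lift (K : set G) (vt rho : set (R -> G) -> R) : Prop :=
  homogeneous_quasimorphism GM rho /\
  forall a, ucover GM K a -> rho (ucover_map GM a) = vt a.

Definition is_guichardet_wigner (K : set G) (vt rho : set (R -> G) -> R) :
    Prop :=
  extends_lift K vt rho /\
  forall rho', extends_lift K vt rho' ->
    forall a, ucover GM setT a -> rho' a = rho a.

End Hermitian.

(* Main.v *)
(* Homogenization makes [nuG] a homogeneous quasimorphism, so by the uniqueness
   of [rho] it suffices to compute [nuG] on a path [p] in the isotropy group of
   [x0].  The orbit of [x0] is then constant and is filled by the constant disk,
   so [nu x0] reduces to minus the integral of the moment map.  A vector
   [xi] tangent to the isotropy group generates a vertical field at [x0], on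
   which the connection form sees only the derivative of the action on the fibre
   of the anticanonical bundle: the moment of the logarithmic velocity of [p] is
   the derivative of the argument of the isotropy character along [p].  Its
   integral is therefore the lifted character at the end of the path. *)

From HB Require Import structures.
Require Import Defs.
From mathcomp Require Import all_boot all_order all_algebra complex.
From mathcomp Require Import all_classical all_reals all_analysis.
From mathcomp Require Import measurable_realfun ring lra.

Set Implicit Arguments.
Unset Strict Implicit.
Unset Printing Implicit Defensive.

Import Order.TTheory GRing.Theory Num.Theory.
Import numFieldNormedType.Exports.

Local Open Scope classical_set_scope.
Local Open Scope ring_scope.
Local Open Scope complex_scope.

(** * Local smoothness *)

(** The lift [vt] is only known to be continuous along paths, so the derivative of the angle has to
    be produced. For s near t the element p(s) p(t)^-1 has the small angle theta(s) - theta(t),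
    which its sine determines, and this sine is the imaginary part of the isotropy character. The
    character is awkward to differentiate as defined, because it compares the preferred charts at x0
    and at g.x0, and the latter changes with g; near 1 it is replaced by a determinant read in one
    fixed chart. Paths are smooth on the whole line but lie in the isotropy group only for times in
    [0, 1], so derivatives are computed at interior times and the endpoints are discarded under the
    integral. Since smoothness means iterated derivatives in constant directions, composing smooth
    maps requires finite-dimensional coordinates. *)

Section LocalSmoothness.
Context {R : realType}.

(* The local counterpart of [Ck], which unlike [Ck] on a singleton is invariant
   under a change of the function away from the point. *)
Fixpoint Cn {V W : normedModType R} (k : nat) (f : V -> W) (x : V) : Prop :=
  match k with
  | 0 => \forall y \near x, {for y, continuous f}
  | k'.+1 => (\forall y \near x, differentiable f y) /\
             forall v, Cn k' (fun y => 'D_v f y) x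
  end.

Lemma Cn_Ck {V W : normedModType R} k (U : set V) (f : V -> W) :
  (forall x, U x -> Cn k f x) -> Ck k U f.
Proof.
elim: k f => [|k IH] f fU /=; first by move=> x /fU /nbhs_singleton.
split; first by move=> x /fU[/nbhs_singleton].
by move=> v; apply: IH => x /fU[_]; exact.
Qed.

Lemma Ck_Cn {V W : normedModType R} k (U : set V) (f : V -> W) x :
  nbhs x U -> Ck k U f -> Cn k f x.
Proof.
move=> Ux; elim: k f => [|k IH] f /=.
  by move=> fU; apply: filterS Ux => y /fU.
move=> [df Df]; split; first by apply: filterS Ux => y /df.
by move=> v; exact: IH.
Qed.

Lemma near_eq_continuous {V W : normedModType R} (f g : V -> W) x :
  (\forall y \near x, f y = g y) -> {for x, continuous f} ->
  {for x, continuous g}.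
Proof.
move=> fg; have fgx : f x = g x := nbhs_singleton fg.
rewrite /prop_for /continuous_at fgx; apply: cvg_trans; apply: near_eq_cvg.
by apply: filterS fg => y ->.
Qed.

(** The first-order expansion sees only values near [x], so the differential of [f] also serves for
    [g]. *)
Lemma near_eq_differentiable {V W : normedModType R} (f g : V -> W) x :
  (\forall y \near x, f y = g y) -> differentiable f x -> differentiable g x.
Proof.
move=> fg df; have [dfc dfo] := (diff_locallyP _ _).1 df.
have dgo : g \o shift x = cst (g x) + 'd f x +o_ 0 id.
  apply/eqaddoP => eps eps0; move/eqaddoP : dfo => /(_ _ eps0) dfo.
  have fgx : f x = g x := nbhs_singleton fg.
  have : \forall h \near 0, f (h + x) = g (h + x).
    move: fg; rewrite (near_shift 0 x); apply: filterS => h /=.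
    by rewrite subr0.
  move=> /filterI /(_ dfo); apply: filterS => h [/= fgh].
  by rewrite /= !fctE /= fgh fgx.
by apply/diff_locallyP; rewrite (diff_unique dfc dgo).
Qed.

Lemma Cn_eq {V W : normedModType R} k (f g : V -> W) x :
  (\forall y \near x, f y = g y) -> Cn k f x -> Cn k g x.
Proof.
elim: k f g => [|k IH] f g /near_join fg /=.
  move=> cf; near=> y.
  have : \forall z \near y, f z = g z by near: y.
  by move/near_eq_continuous; apply; near: y.
case=> df Df; split.
  near=> y; have : \forall z \near y, f z = g z by near: y.
  by move/near_eq_differentiable; apply; near: y.
move=> v; apply: IH (Df v).
near=> y; apply: near_eq_derive; near: y; exact: fg.
Unshelve. all: by end_near. Qed.


Lemma CnS {V W : normedModType R} k (f : V -> W) x : Cn k.+1 f x -> Cn k f x.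
Proof.
elim: k f => [|k IH] f.
  by case=> df _; apply: filterS df => y /differentiable_continuous.
by case=> df Df; split=> // v; exact: IH.
Qed.

Lemma Cn_differentiable {V W : normedModType R} k (f : V -> W) x :
  Cn k.+1 f x -> differentiable f x.
Proof. by case=> /nbhs_singleton. Qed.

Lemma Cn_continuous {V W : normedModType R} k (f : V -> W) x :
  Cn k f x -> {for x, continuous f}.
Proof. by elim: k => [/nbhs_singleton//|k IH] /CnS. Qed.

Lemma Cn_cst {V W : normedModType R} k (w : W) (x : V) : Cn k (cst w) x.
Proof.
elim: k w => [|k IH] w /=; first by near=> y; exact: cst_continuous.
split; first by near=> y; exact: differentiable_cst.
move=> v; rewrite (_ : (fun y => _) = cst 0) ?derive_cst//.
by apply/funext => y; exact: derive_cst.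
Unshelve. all: by end_near. Qed.

Lemma CnD {V W : normedModType R} k (f g : V -> W) x :
  Cn k f x -> Cn k g x -> Cn k (fun y => f y + g y) x.
Proof.
elim: k f g => [|k IH] f g /=.
  by move=> cf cg; near=> y; apply: continuousD; near: y.
move=> [df Df] [dg Dg]; split.
  by near=> y; apply: differentiableD; near: y.
move=> v; apply: Cn_eq (IH _ _ (Df v) (Dg v)).
near=> y; rewrite -deriveD//; apply: diff_derivable; near: y; first exact: df.
exact: dg.
Unshelve. all: by end_near. Qed.

Lemma Cn_sum {V W : normedModType R} (I : Type) (r : seq I) k
    (f : I -> V -> W) x :
  (forall i, Cn k (f i) x) -> Cn k (fun y => \sum_(i <- r) f i y) x.
Proof.
move=> fC; elim: r => [|i r IH].
  under eq_fun do rewrite big_nil.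
  exact: Cn_cst.
under eq_fun do rewrite big_cons.
exact: CnD.
Qed.

Lemma derive_linear {V W W' : normedModType R} (l : {linear W -> W'})
    (f : V -> W) x v : continuous l -> differentiable f x ->
  'D_v (l \o f) x = l ('D_v f x).
Proof.
move=> lc df; have dl := linear_differentiable (f x) lc.
rewrite !deriveE//; last exact: differentiable_comp.
by rewrite diff_comp//= diff_lin.
Qed.

Lemma Cn_linear {V W W' : normedModType R} k (l : {linear W -> W'})
    (f : V -> W) x : continuous l -> Cn k f x -> Cn k (l \o f) x.
Proof.
move=> lc; elim: k f => [|k IH] f /=.
  move=> cf; near=> y; apply: continuous_comp; last exact: lc.
  by near: y.
move=> [df Df]; split.
  near=> y; apply: differentiable_comp; first by near: y.
  exact: linear_differentiable.
move=> v; apply: Cn_eq (IH _ (Df v)).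
near=> y; rewrite derive_linear//; near: y; exact: df.
Unshelve. all: by end_near. Qed.

(** Scaling is a continuous bilinear map, so the product rule is the chain rule through the pair of
    [a] and [f]. *)
Lemma is_diff_scale {V W : normedModType R} (a : V -> R) (f : V -> W) x :
  differentiable a x -> differentiable f x ->
  is_diff x (fun y => a y *: f y) (fun v => a x *: 'd f x v + 'd a x v *: f x).
Proof.
move=> da df.
have bil : bilinear_for (GRing.Scale.Law.clone _ _ *:%R _)
    (GRing.Scale.Law.clone _ _ *:%R _) (fun (c : R) (w : W) => c *: w).
  split=> [w|c] b y z /=; first by rewrite scalerDl scalerA.
  by rewrite scalerDr !scalerA mulrC.
pose sB := bilinear_isBilinear.Build R R W W _ _
  (fun (c : R) (w : W) => c *: w) bil.
pose s : {bilinear R -> W -> W} := HB.pack (fun (c : R) (w : W) => c *: w) sB.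
have cs : continuous (fun p : R * W => s p.1 p.2) by exact: scale_continuous.
have ds p := differentiable_bilin p cs.
have dp := differentiable_pair da df.
apply: DiffDef; first exact: (differentiable_comp dp (ds _)).
rewrite (diff_comp dp (ds _)) diff_bilin//.
by apply/funext => v /=; rewrite diff_pair.
Qed.

Lemma CnZ {V W : normedModType R} k (a : V -> R) (f : V -> W) x :
  Cn k a x -> Cn k f x -> Cn k (fun y => a y *: f y) x.
Proof.
elim: k a f => [|k IH] a f.
  by move=> ca cf; near=> y; apply: cvgZ; near: y.
move=> /[dup] /CnS aC [da Da] /[dup] /CnS fC [df Df]; split.
  near=> y; have dy : differentiable a y by near: y.
  have dfy : differentiable f y by near: y.
  by have [] := is_diff_scale dy dfy.
move=> v; apply: Cn_eq (CnD (IH _ _ aC (Df v)) (IH _ _ (Da v) fC)).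
near=> y; have dy : differentiable a y by near: y.
have dfy : differentiable f y by near: y.
have [d e] := is_diff_scale dy dfy.
by rewrite [RHS]deriveE// e -!deriveE.
Unshelve. all: by end_near. Qed.

Lemma Cn_pair {V W W' : normedModType R} k (f : V -> W) (g : V -> W') x :
  Cn k f x -> Cn k g x -> Cn k (fun y => (f y, g y)) x.
Proof.
elim: k f g => [|k IH] f g /=.
  by move=> cf cg; near=> y; apply: cvg_pair; near: y.
move=> [df Df] [dg Dg]; split.
  by near=> y; apply: differentiable_pair; near: y.
move=> v; apply: Cn_eq (IH _ _ (Df v) (Dg v)).
near=> y; have dy : differentiable f y by near: y.
have dgy : differentiable g y by near: y.
by rewrite !deriveE ?diff_pair//; exact: differentiable_pair.
Unshelve. all: by end_near. Qed.

Lemma derive_comp {U V W : normedModType R} (f : U -> V) (g : V -> W) x u :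
  differentiable f x -> differentiable g (f x) ->
  'D_u (g \o f) x = 'D_('D_u f x) g (f x).
Proof.
move=> df dg; rewrite !deriveE//; last exact: differentiable_comp.
by rewrite diff_comp.
Qed.

Lemma Cn_id {V : normedModType R} k (x : V) : Cn k id x.
Proof.
case: k => [|k]; first by near=> y; exact: cvg_id.
split; first by near=> y.
move=> v; rewrite (_ : (fun y => _) = cst v); first exact: Cn_cst.
by apply/funext => y; exact: derive_id.
Unshelve. all: by end_near. Qed.

Lemma Cn_scale (a : R) k (x : R) : Cn k (fun t : R => a * t) x.
Proof. exact: (CnZ (Cn_cst k a x) (Cn_id k x)). Qed.

Lemma Cn_fst {V W : normedModType R} k (z : V * W) : Cn k fst z.
Proof.
have cfst : continuous (fst : V * W -> _) by move=> w; exact: cvg_fst.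
exact: (Cn_linear cfst (Cn_id k z)).
Qed.

Lemma Cn_snd {V W : normedModType R} k (z : V * W) : Cn k snd z.
Proof.
have csnd : continuous (snd : V * W -> _) by move=> w; exact: cvg_snd.
exact: (Cn_linear csnd (Cn_id k z)).
Qed.

(** Finite dimension in the form that the higher chain rule uses: a moving direction becomes a
    finite combination of constant ones, with continuous linear coefficients. *)
Definition has_coordinates (E : normedModType R) : Prop :=
  exists (I : finType) (b : I -> E) (l : I -> {linear E -> R}),
    (forall i, continuous (l i)) /\ forall w, w = \sum_i l i w *: b i.

Lemma has_coordinates_rV n : has_coordinates 'rV[R]_n.
Proof.
have li i : linear (fun w : 'rV[R]_n => w 0 i).
  by move=> a u v; rewrite !mxE.
pose L i : {linear 'rV[R]_n -> R} :=
  HB.pack (fun w : 'rV[R]_n => w 0 i) (GRing.isLinear.Build _ _ _ _ _ (li i)).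
exists 'I_n, (fun i => delta_mx 0 i), L; split.
  by move=> i; exact: coord_continuous.
by move=> w; exact: row_sum_delta.
Qed.

Lemma has_coordinates_R : has_coordinates R.
Proof.
exists unit, (fun=> 1), (fun=> idfun); split.
  by move=> _ x; exact: cvg_id.
by move=> w; rewrite big_const card_unit /= addr0 -[RHS]/(w * 1) mulr1.
Qed.

Lemma has_coordinates_prod (E F : normedModType R) :
  has_coordinates E -> has_coordinates F -> has_coordinates (E * F)%type.
Proof.
move=> [I [b [l [lc lE]]]] [J [c [m [mc mE]]]].
pose L (k : I + J) : {linear (E * F)%type -> R} :=
  match k with inl i => l i \o fst | inr j => m j \o snd end.
exists (I + J)%type,
  (fun k => match k with inl i => (b i, 0) | inr j => (0, c j) end), L.
split.
  move=> [i|j] x; apply: continuous_comp.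
  - exact: cvg_fst.
  - exact: lc.
  - exact: cvg_snd.
  - exact: mc.
move=> w; rewrite big_sumType/=; apply: injective_projections => /=.
  rewrite [LHS]lE !raddf_sum/= [X in _ + X]big1 ?addr0// => j _.
  exact: scaler0.
rewrite [LHS]mE !raddf_sum/= [X in X + _]big1 ?add0r// => i _.
exact: scaler0.
Qed.

Lemma Cn_comp {U V W : normedModType R} k (f : U -> V) (g : V -> W) x :
  has_coordinates V -> Cn k f x -> Cn k g (f x) -> Cn k (g \o f) x.
Proof.
move=> [I [b [l [lc lE]]]].
elim: k f g => [|k IH] f g.
  move=> cf cg; have cfx : {for x, continuous f} := nbhs_singleton cf.
  have cgf : \forall y \near x, {for f y, continuous g} := cfx _ cg.
  by near=> y; apply: continuous_comp; near: y.
move=> /[dup] /CnS fC [df Df] [dg Dg].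
have cfx : {for x, continuous f} := Cn_continuous fC.
have dgf : \forall y \near x, differentiable g (f y) := cfx _ dg.
split; first by near=> y; apply: differentiable_comp; near: y.
move=> u.
have lC i : Cn k (fun y => l i ('D_u f y)) x.
  exact: (Cn_linear (lc i) (Df u)).
have gC i : Cn k (fun y => 'D_(b i) g (f y)) x by exact: (IH f _ fC (Dg (b i))).
(* The chain rule differentiates [g] in the direction ['D_u f y], which varies with [y]. Expanded
   along [b], it is a sum of products to which the induction hypothesis applies. *)
apply: Cn_eq (Cn_sum (index_enum I) (fun i => CnZ (lC i) (gC i))).
near=> y; have dy : differentiable f y by near: y.
have dgy : differentiable g (f y) by near: y.
rewrite derive_comp// [RHS]deriveE// [in RHS](lE ('D_u f y)) linear_sum/=.
by apply: eq_bigr => i _; rewrite (deriveE _ dgy) linearZ.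
Unshelve. all: by end_near. Qed.

End LocalSmoothness.

(** * Smooth maps between manifolds *)

Section Charts.
Context {R : realType} {E : normedModType R} {M : topologicalType}.
Variable A : manifold M E.
Implicit Types (c : chart M E) (x : M).

Lemma near_dom c x : atlas A c -> dom c x -> \forall y \near x, dom c y.
Proof.
by move=> /atlas_is_chart[oc _ _ _ _] dx; exact: open_nbhs_nbhs.
Qed.

Lemma near_im c x : atlas A c -> dom c x -> \forall z \near c x, im c z.
Proof.
move=> /atlas_is_chart[_ oc _ _ _] dx; apply: open_nbhs_nbhs; split=> //.
by exists x.
Qed.

Lemma chartK c x : atlas A c -> dom c x -> param c (c x) = x.
Proof. by move=> /atlas_is_chart[_ _ + _ _]; exact. Qed.

Lemma paramK c z : atlas A c -> im c z -> c (param c z) = z.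
Proof. by move=> cA [x dx <-]; rewrite chartK. Qed.

Lemma param_dom c z : atlas A c -> im c z -> dom c (param c z).
Proof. by move=> cA [x dx <-]; rewrite chartK. Qed.

Lemma param_continuous c x : atlas A c -> dom c x ->
  {for c x, continuous (param c)}.
Proof. by move=> /atlas_is_chart[_ _ _ _ +] dx; apply; exists x. Qed.

(** Chart domains are open, so their preimages under a continuous [f] are neighbourhoods and
    smoothness can be tested point by point. *)
Lemma smooth_intoP {V : normedModType R} (f : V -> M) :
  smooth_into A f <-> continuous f /\
    forall c v k, atlas A c -> dom c (f v) -> Cn k (c \o f) v.
Proof.
split=> -[fc fs]; split=> //.
  move=> c v k cA dv; apply: Ck_Cn (fs _ cA k).
  exact: (fc v _ (near_dom cA dv)).
by move=> c cA k; apply: Cn_Ck => v; exact: fs.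
Qed.

Lemma smooth_into_cst {V : normedModType R} x : smooth_into A (fun _ : V => x).
Proof.
apply/smooth_intoP; split; first by move=> v; exact: cst_continuous.
by move=> c v k cA dx; exact: Cn_cst.
Qed.

Lemma smooth_into_comp {V W : normedModType R} (f : W -> M) (g : V -> W) :
  has_coordinates W -> (forall k v, Cn k g v) -> smooth_into A f ->
  smooth_into A (f \o g).
Proof.
move=> Wc gs /smooth_intoP[fc fs]; apply/smooth_intoP; split.
  move=> v; apply: continuous_comp; last exact: fc.
  exact: (Cn_continuous (gs 0 v)).
by move=> c v k cA dx; exact: (Cn_comp Wc (gs k v) (fs _ _ k cA dx)).
Qed.

End Charts.

Section SmoothMaps.
Context {R : realType} {E1 E2 E' : normedModType R}
  {M1 M2 M' : topologicalType}.
Variables (A1 : manifold M1 E1) (A2 : manifold M2 E2) (A' : manifold M' E').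

Lemma smooth_map_Cn (f : M1 -> M') c d x k : smooth_map A1 A' f ->
  atlas A1 c -> atlas A' d -> dom c x -> dom d (f x) ->
  Cn k (d \o f \o param c) (c x).
Proof.
move=> [fc fs] cA dA dx dfx; apply: Ck_Cn (fs _ _ cA dA k).
have pc := param_continuous cA dx.
rewrite /prop_for /continuous_at (chartK cA dx) in pc.
have near_d : \forall z \near c x, dom d (f (param c z)).
  exact: (pc _ (fc x _ (near_dom dA dfx))).
near=> z.
have zc : im c z by near: z; exact: (near_im cA dx).
exists (param c z); last exact: (paramK cA zc).
by split; [exact: (param_dom cA zc)|near: z].
Unshelve. all: by end_near. Qed.

Lemma smooth_map2_Cn (f : M1 -> M2 -> M') c1 c2 d x y k :
  smooth_map2 A1 A2 A' f ->
  atlas A1 c1 -> atlas A2 c2 -> atlas A' d ->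
  dom c1 x -> dom c2 y -> dom d (f x y) ->
  Cn k (fun z : E1 * E2 => d (f (param c1 z.1) (param c2 z.2))) (c1 x, c2 y).
Proof.
move=> [fc fs] c1A c2A dA dx dy dfxy; apply: Ck_Cn (fs _ _ _ c1A c2A dA k).
have pc1 := param_continuous c1A dx.
rewrite /prop_for /continuous_at (chartK c1A dx) in pc1.
have pc2 := param_continuous c2A dy.
rewrite /prop_for /continuous_at (chartK c2A dy) in pc2.
have pc : (param c1 z.1, param c2 z.2) @[z --> (c1 x, c2 y)] --> (x, y).
  apply: cvg_pair.
    by apply: cvg_comp pc1; exact: cvg_fst.
  by apply: cvg_comp pc2; exact: cvg_snd.
have near_d : \forall z \near (c1 x, c2 y),
    dom d (f (param c1 z.1) (param c2 z.2)).
  exact: (pc _ (fc (x, y) _ (near_dom dA dfxy))).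
have i1 : \forall z \near (c1 x, c2 y), im c1 z.1.
  exact: (cvg_fst (near_im c1A dx)).
have i2 : \forall z \near (c1 x, c2 y), im c2 z.2.
  exact: (cvg_snd (near_im c2A dy)).
by near=> z; split; near: z.
Unshelve. all: by end_near. Qed.

Lemma smooth_into_map {V : normedModType R} (f : M1 -> M') (p : V -> M1) :
  has_coordinates E1 -> smooth_map A1 A' f -> smooth_into A1 p ->
  smooth_into A' (f \o p).
Proof.
move=> E1c fs /smooth_intoP[pc ps]; apply/smooth_intoP; split.
  by move=> v; apply: continuous_comp; [exact: pc|exact: fs.1].
move=> d v k dA dfv.
pose c := chart_at A1 (p v).
have cA : atlas A1 c := chart_at_atlas A1 (p v).
have cv : dom c (p v) := chart_at_dom A1 (p v).
apply: Cn_eq (Cn_comp E1c (ps _ v k cA cv) (smooth_map_Cn k fs cA dA cv dfv)).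
near=> w => /=; rewrite (chartK cA)//; near: w.
exact: (pc v _ (near_dom cA cv)).
Unshelve. all: by end_near. Qed.

Lemma smooth_into_map2 {V : normedModType R} (f : M1 -> M2 -> M')
    (p : V -> M1) (q : V -> M2) :
  has_coordinates E1 -> has_coordinates E2 -> smooth_map2 A1 A2 A' f ->
  smooth_into A1 p -> smooth_into A2 q ->
  smooth_into A' (fun v => f (p v) (q v)).
Proof.
move=> E1c E2c fs /smooth_intoP[pc ps] /smooth_intoP[qc qs].
have pqc : continuous (fun v => (p v, q v)).
  by move=> v; apply: cvg_pair; [exact: pc|exact: qc].
apply/smooth_intoP; split.
  by move=> v; exact: (continuous_comp (pqc v) (fs.1 _)).
move=> d v k dA dfv.
pose c1 := chart_at A1 (p v).
have c1A : atlas A1 c1 := chart_at_atlas A1 (p v).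
have c1v : dom c1 (p v) := chart_at_dom A1 (p v).
pose c2 := chart_at A2 (q v).
have c2A : atlas A2 c2 := chart_at_atlas A2 (q v).
have c2v : dom c2 (q v) := chart_at_dom A2 (q v).
apply: Cn_eq (Cn_comp (has_coordinates_prod E1c E2c)
  (Cn_pair (ps _ v k c1A c1v) (qs _ v k c2A c2v))
  (smooth_map2_Cn k fs c1A c2A dA c1v c2v dfv)).
near=> w => /=; rewrite !(chartK c1A, chartK c2A)//; near: w.
  exact: (qc v _ (near_dom c2A c2v)).
exact: (pc v _ (near_dom c1A c1v)).
Unshelve. all: by end_near. Qed.

End SmoothMaps.

(** * The universal cover *)

(** Homotopies are continuous only within the square, so reparametrizing one requires a map that
    stays in the square. *)
Lemma within_continuous_comp_sub {U V W : topologicalType} (S : set U)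
    (T : set V) (h : U -> V) (f : V -> W) :
  (forall x, S x -> T (h x)) -> continuous h ->
  {within T, continuous f} -> {within S, continuous (f \o h)}.
Proof.
move=> ST hc /subspace_continuousP fc; apply/subspace_continuousP => x Sx.
apply: cvg_comp (fc _ (ST _ Sx)) => P /= TP.
have : \forall y \near x, T (h y) -> P (h y) := hc x _ TP.
by apply: filterS => y yP Sy; apply: yP; exact: ST.
Qed.

Section UniversalCover.
Context {R : realType} {n : nat} {G : topGroupType}.
Variable GM : manifold G 'rV[R]_n.
Hypothesis lieG : is_lie_group GM.
Variable A : set G.
Hypothesis subA : is_subgroup A.
Implicit Types p q : R -> G.

Local Notation square := (@unit_itv R `*` @unit_itv R).

Lemma closed_unit_itv : closed (@unit_itv R).
Proof.
have -> : @unit_itv R = [set t | 0 <= t] `&` [set t | t <= 1].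
  by apply/seteqP; split=> t; rewrite /unit_itv/= => /andP.
by apply: closedI; [exact: closed_ge|exact: closed_le].
Qed.

Lemma closed_square : closed square.
Proof.
have -> : square = fst @^-1` unit_itv `&` snd @^-1` unit_itv by [].
by apply: closedI; apply: preimage_closed => [z _|];
  [exact: cvg_fst|exact: closed_unit_itv|exact: cvg_snd|exact: closed_unit_itv].
Qed.

Lemma smooth_path_mul p q : smooth_path GM A p -> smooth_path GM A q ->
  smooth_path GM A (fun t => (p t * q t)%g).
Proof.
move=> [ps p0 pA] [qs q0 qA]; split.
- by apply: smooth_into_map2 lieG.1 ps qs; exact: has_coordinates_rV.
- by rewrite p0 q0 mul1g.
- by case: subA => _ + _ => AM t tI; apply: AM; [exact: pA|exact: qA].
Qed.

Lemma smooth_path1 : smooth_path GM A (fun=> 1%g).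
Proof. by split=> //; [exact: smooth_into_cst|case: subA]. Qed.

Lemma smooth_path_exp p k : smooth_path GM A p ->
  smooth_path GM A (fun t => (p t ^+ k)%g).
Proof.
move=> ps; elim: k => [|k IH].
  under eq_fun do rewrite expg0; exact: smooth_path1.
by under eq_fun do rewrite expgS; exact: smooth_path_mul.
Qed.

Lemma homotopic_refl p : smooth_path GM A p -> homotopic A p p.
Proof.
move=> [[pc _] p0 pA]; exists (fun z => p z.1); split.
  apply: continuous_subspaceT => z.
  by apply: (@continuous_comp _ _ _ fst p); [exact: cvg_fst|exact: pc].
by move=> t tI; split=> // s _; exact: pA.
Qed.

Lemma unit_itv1 : @unit_itv R 1. Proof. by rewrite /unit_itv/= lexx ler01. Qed.

Lemma homotopic_sym p q : homotopic A p q -> homotopic A q p.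
Proof.
move=> [H [Hc Hp]].
(* Read at the corner (1, 1): the fixed endpoint, stated in terms of [p], is also that of [q]. *)
have q1 : q 1 = p 1 by case: (Hp 1 unit_itv1) => _ _ <- _ <-.
have rI t : unit_itv t -> @unit_itv R (1 - t).
  by rewrite /unit_itv/= => /andP[t0 t1]; apply/andP; split; lra.
pose r (z : R * R) := (z.1, 1 - z.2).
have rc : continuous r.
  move=> z; have z1 : w.1 @[w --> z] --> z.1 by exact: cvg_fst.
  have z2 : w.2 @[w --> z] --> z.2 by exact: cvg_snd.
  exact: cvg_pair z1 (cvgB (cvg_cst _) z2).
exists (H \o r); split.
  apply: (within_continuous_comp_sub _ rc Hc) => z [z1 z2]; split=> //.
  exact: rI.
move=> t tI; have [HA H0 H1 _ _] := Hp t tI.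
have [_ _ _ HL HR] := Hp _ (rI _ tI).
rewrite /= /r /=; split=> //; rewrite ?subr0 ?subrr// ?q1//.
by move=> s sI; apply: HA; exact: rI.
Qed.

Lemma homotopic_trans p q r :
  homotopic A p q -> homotopic A q r -> homotopic A p r.
Proof.
move=> [H [Hc Hp]] [H' [Hc' Hp']].
have q1 : q 1 = p 1 by case: (Hp 1 unit_itv1) => _ _ <- _ <-.
pose h1 (z : R * R) := (z.1, 2 * z.2).
pose h2 (z : R * R) := (z.1, 2 * z.2 - 1).
have h1c : continuous h1.
  move=> z; have z1 : w.1 @[w --> z] --> z.1 by exact: cvg_fst.
  have z2 : w.2 @[w --> z] --> z.2 by exact: cvg_snd.
  exact: cvg_pair z1 (cvgM (cvg_cst _) z2).
have h2c : continuous h2.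
  move=> z; have z1 : w.1 @[w --> z] --> z.1 by exact: cvg_fst.
  have z2 : w.2 @[w --> z] --> z.2 by exact: cvg_snd.
  exact: cvg_pair z1 (cvgB (cvgM (cvg_cst _) z2) (cvg_cst _)).
pose S1 : set (R * R) := square `&` [set z | z.2 <= 2^-1].
pose S2 : set (R * R) := square `&` [set z | 2^-1 <= z.2].
pose K z := if z.2 <= 2^-1 then H (h1 z) else H' (h2 z).
have clow : closed [set z : R * R | z.2 <= 2^-1].
  rewrite (_ : [set z | _] = snd @^-1` [set t : R | t <= 2^-1])//.
  apply: preimage_closed => [z _|]; first exact: cvg_snd.
  exact: closed_le.
have cup : closed [set z : R * R | 2^-1 <= z.2].
  rewrite (_ : [set z | _] = snd @^-1` [set t : R | 2^-1 <= t])//.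
  apply: preimage_closed => [z _|]; first exact: cvg_snd.
  exact: closed_ge.
have h1I t : unit_itv t -> t <= 2^-1 -> @unit_itv R (2 * t).
  by rewrite /unit_itv/= => /andP[t0 t1] t2; apply/andP; split; lra.
have h2I t : unit_itv t -> 2^-1 <= t -> @unit_itv R (2 * t - 1).
  by rewrite /unit_itv/= => /andP[t0 t1] t2; apply/andP; split; lra.
exists K; split.
  (* The two homotopies are stacked in the second variable and glued along closed halves of the
     square. *)
  have -> : square = S1 `|` S2.
    rewrite -setIUr [X in _ = _ `&` X](_ : _ = setT) ?setIT//.
    apply/seteqP; split=> // z _ /=.
    by case: (leP z.2 2^-1) => [|/ltW]; [left|right].
  apply: withinU_continuous.
  - by apply: closedI => //; exact: closed_square.
  - by apply: closedI => //; exact: closed_square.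
  - apply: (@subspace_eq_continuous _ _ _ (H \o h1)).
      by move=> z /set_mem[_ /= z2]; rewrite /from_subspace /K z2.
    apply: (within_continuous_comp_sub _ h1c Hc) => z [[z1 z2] z3]; split=> //.
    exact: h1I.
  - apply: (@subspace_eq_continuous _ _ _ (H' \o h2)).
      move=> z /set_mem[[z1 _] /= z2]; rewrite /from_subspace /K.
      (* On the common edge [K] takes the value of [H]; both homotopies equal [q] there. *)
      case: ifPn => // z2'; have {z2 z2'} z2 : z.2 = 2^-1.
        by apply/eqP; rewrite eq_le z2 z2'.
      rewrite /= /h1 /h2 z2 divff ?pnatr_eq0// subrr.
      by have [_ _ -> _ _] := Hp _ z1; have [_ -> _ _ _] := Hp' _ z1.
    apply: (within_continuous_comp_sub _ h2c Hc') => z [[z1 z2] z3]; split=> //.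
    exact: h2I.
move=> t tI; rewrite /K /h1 /h2 /=.
have [HA H0 H1 _ _] := Hp t tI; have [HA' H0' H1' _ _] := Hp' t tI.
split.
- move=> s sI; case: (leP s 2^-1) => s2; first by apply: HA; exact: h1I.
  by apply: HA'; apply: h2I => //; exact: ltW.
- by rewrite invr_ge0 ler0n mulr0.
- by rewrite ifF ?mulr1; [rewrite (_ : 2 - 1 = 1)//; lra|apply/negbTE; lra].
- case: (leP t 2^-1) => t2; first by have [] := Hp _ (h1I _ tI t2).
  by have [] := Hp' _ (h2I _ tI (ltW t2)).
- case: (leP t 2^-1) => t2; first by have [] := Hp _ (h1I _ tI t2).
  by have [_ _ _ _ ->] := Hp' _ (h2I _ tI (ltW t2)).
Qed.

Lemma homotopic_mul p p' q q' : homotopic A p p' -> homotopic A q q' ->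
  homotopic A (fun t => (p t * q t)%g) (fun t => (p' t * q' t)%g).
Proof.
move=> [H [Hc Hp]] [H' [Hc' Hp']].
exists (fun z => (H z * H' z)%g); split.
  (* [topGroupType] merely juxtaposes a topology and a group law; continuity of the product comes
     from the smoothness of the multiplication. *)
  move=> z; have := lieG.1.1 (H z, H' z).
  apply: (@cvg_comp _ _ _ (fun z : subspace square => (H z, H' z))
    (fun xy : G * G => (xy.1 * xy.2)%g)).
  by apply: cvg_pair; [exact: Hc|exact: Hc'].
move=> t tI; have [HA H0 H1 HL HR] := Hp t tI.
have [HA' H0' H1' HL' HR'] := Hp' t tI.
split; rewrite ?H0 ?H0' ?H1 ?H1' ?HL ?HL' ?HR ?HR' ?mul1g//.
by case: subA => _ + _ => AM s sI; apply: AM; [exact: HA|exact: HA'].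
Qed.

Lemma path_class_refl p : smooth_path GM A p -> path_class GM A p p.
Proof. by move=> ps; split=> //; exact: homotopic_refl. Qed.

Lemma path_class_eq p q : homotopic A p q ->
  path_class GM A p = path_class GM A q.
Proof.
move=> pq; apply/seteqP; split=> r [rs] h; split=> //.
  exact: homotopic_trans (homotopic_sym pq) h.
exact: homotopic_trans pq h.
Qed.

Lemma ucover_class p : smooth_path GM A p -> ucover GM A (path_class GM A p).
Proof. by move=> ps; exists p. Qed.

Lemma ucover_mulE p q : smooth_path GM A p -> smooth_path GM A q ->
  ucover_mul GM A (path_class GM A p) (path_class GM A q) =
  path_class GM A (fun t => (p t * q t)%g).
Proof.
move=> ps qs; apply/seteqP; split=> r.
  move=> [p' [q' [[_ pp'] [_ qq']]]].
  by rewrite -(path_class_eq (homotopic_mul pp' qq')).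
by move=> rc; exists p, q; split=> //; exact: path_class_refl.
Qed.

Lemma ucover_expE p k : smooth_path GM A p ->
  ucover_exp GM A (path_class GM A p) k =
  path_class GM A (fun t => (p t ^+ k)%g).
Proof.
move=> ps; elim: k => [|k IH].
  by under [in RHS]eq_fun do rewrite expg0.
rewrite /ucover_exp iterS -/(ucover_exp GM A _ k) IH ucover_mulE//.
  by under [in RHS]eq_fun do rewrite expgS.
exact: smooth_path_exp.
Qed.

End UniversalCover.

Section UniversalCoverMap.
Context {R : realType} {n : nat} {G : topGroupType}.
Variable GM : manifold G 'rV[R]_n.
Implicit Types p q : R -> G.

Lemma smooth_pathT (A : set G) p :
  smooth_path GM A p -> smooth_path GM setT p.
Proof. by move=> [ps p0 _]. Qed.

Lemma ucover_mapE (A : set G) p : smooth_path GM A p ->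
  ucover_map GM (path_class GM A p) = path_class GM setT p.
Proof.
move=> ps; apply/seteqP; split=> r.
  move=> [q [_ [H [Hc Hp]]]].
  suff /path_class_eq -> : homotopic setT p q by [].
  by exists H; split=> // t /Hp[].
by move=> rc; exists p => //; exact: path_class_refl.
Qed.

End UniversalCoverMap.

(** * Homogenization *)

Section Homogenization.
Context {R : realType} {n : nat} {G : topGroupType}.
Variable GM : manifold G 'rV[R]_n.
Hypothesis lieG : is_lie_group GM.
Variables f g : set (R -> G) -> R.
Hypothesis fqm : quasimorphism GM f.
Hypothesis fg : forall a, ucover GM setT a ->
  (fun k : nat => f (ucover_exp GM setT a k) / k%:R) @ \oo --> g a.

Lemma ucover_exp_in a k : ucover GM setT a ->
  ucover GM setT (ucover_exp GM setT a k).
Proof.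
move=> [p ps ->]; rewrite ucover_expE//.
by apply: ucover_class; exact: smooth_path_exp.
Qed.

Lemma ucover_expM a k m : ucover GM setT a ->
  ucover_exp GM setT (ucover_exp GM setT a k) m =
  ucover_exp GM setT a (k * m)%N.
Proof.
move=> [p ps ->]; rewrite !ucover_expE//; last exact: smooth_path_exp.
by under eq_fun do rewrite -expgnA.
Qed.

Lemma ucover_mul_in a b : ucover GM setT a -> ucover GM setT b ->
  ucover GM setT (ucover_mul GM setT a b).
Proof.
move=> [p ps ->] [q qs ->]; rewrite ucover_mulE//.
by apply: ucover_class; exact: smooth_path_mul.
Qed.

(** Peeling off one factor at a time costs C each, so f(a^k) differs from k f(a) by at most k C +
    |f(e)|, where the last term comes from a^0 = e. Dividing by k and passing to the limit gives the
    constant. *)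
Lemma homogenization_dist :
  exists C, forall a, ucover GM setT a -> `|g a - f a| <= C.
Proof.
have [C fC] := fqm; pose e := path_class GM setT (fun=> 1%g).
exists (C + `|f e|) => a aU.
have bound k : `|f (ucover_exp GM setT a k) - f a *+ k| <= C *+ k + `|f e|.
  elim: k => [|k IH]; first by rewrite !mulr0n subr0 add0r.
  have := fC a _ aU (ucover_exp_in k aU).
  rewrite -[ucover_mul _ _ _ _]/(ucover_exp GM setT a k.+1) => ak.
  rewrite !mulrS [leRHS](_ : _ = C + (C *+ k + `|f e|)); last by rewrite addrA.
  apply: le_trans (lerD ak IH).
  set X := f _; set Y := f (ucover_exp _ _ _ k).
  have -> : X - (f a + f a *+ k) = (X - f a - Y) + (Y - f a *+ k) by ring.
  exact: ler_normD.
have C0 : 0 <= C.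
  exact: le_trans (normr_ge0 _) (fC a a aU aU).
have cg : `|f (ucover_exp GM setT a k) / k%:R - f a| @[k --> \oo]
    --> `|g a - f a|.
  by apply: cvg_norm; apply: cvgB; [exact: fg|exact: cvg_cst].
apply: (cvgr_to_le cg); near=> k.
have k0 : (0 < k)%N by near: k; exact: nbhs_infty_gt.
have k0' : 0 < k%:R :> R by rewrite ltr0n.
rewrite -(ler_pM2r k0') -[X in _ * X <= _](gtr0_norm k0') -normrM mulrBl.
rewrite divfK ?gt_eqF// mulr_natr mulrDl mulr_natr.
apply: le_trans (bound k) _; rewrite lerD2l ler_peMr// ler1n//.
Unshelve. all: by end_near. Qed.

(** The powers of a^k are a subsequence of the powers of a: f(a^(k m)) / m is k times f(a^(k m)) /
    (k m), which tends to k g(a). *)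
Lemma homogenization_exp_pos a k : (0 < k)%N -> ucover GM setT a ->
  g (ucover_exp GM setT a k) = g a *+ k.
Proof.
move=> k0 aU.
have lim1 := fg (ucover_exp_in k aU).
have lim2 : f (ucover_exp GM setT a (k * m)%N) / (k * m)%N%:R
    @[m --> \oo] --> g a.
  exact: (cvg_comp (fun m => (k * m)%N) _ (cvg_mulnl _ k0) (fg aU)).
have lim3 : (k%:R : R) * (f (ucover_exp GM setT a (k * m)) / (k * m)%N%:R)
    @[m --> \oo] --> k%:R * g a.
  by apply: cvgM lim2; exact: cvg_cst.
rewrite -mulr_natl -(cvg_lim _ lim1)//; apply: cvg_lim => //.
apply: (cvg_trans _ lim3); apply: near_eq_cvg.
near=> m; rewrite /= ucover_expM// -mulr_natr natrM invfM; field.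
rewrite !pnatr_eq0 -!lt0n k0 andbT//=.
by near: m; exact: nbhs_infty_gt.
Unshelve. all: by end_near. Qed.

Lemma homogenization_quasimorphism : homogeneous_quasimorphism GM g.
Proof.
split.
  have [C fC] := fqm; have [D gD] := homogenization_dist.
  exists (C + D + D + D) => a b aU bU.
  have abU := ucover_mul_in aU bU.
  move: (fC _ _ aU bU) (gD _ abU) (gD _ aU) (gD _ bU).
  rewrite !ler_norml => /andP[? ?] /andP[? ?] /andP[? ?] /andP[? ?].
  by apply/andP; split; lra.
move=> a [|k] aU; last exact: homogenization_exp_pos.
(* For the exponent 0: a^0 is its own square, so its value is twice itself. *)
have eU := ucover_exp_in 0 aU.
have := homogenization_exp_pos (isT : (0 < 2)%N) eU.
rewrite ucover_expM// mulr0n mulr2n => /eqP.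
by rewrite -subr_eq0 opprD addNKr oppr_eq0 => /eqP.
Qed.

End Homogenization.

(** * Derivatives and complex determinants *)

Section PartialDerivatives.
Context {R : realType} {U V W : normedModType R}.

(** Viewed as a directional derivative of the joint map, a partial derivative inherits regularity in
    the other variable. *)
Lemma derive_fst (f : U * V -> W) a b u :
  'D_u (fun x => f (x, b)) a = 'D_(u, 0) f (a, b).
Proof.
rewrite /derive; set d := fun _ : R => _; set d' := fun _ : R => _.
suff -> : d = d' by []; apply/funext => h; rewrite /d /d' /=.
have -> : h *: (u, 0) + (a, b) = (h *: u + a, b) :> U * V.
  by apply: injective_projections; rewrite //= scaler0 add0r.
by [].
Qed.

Lemma derive_snd (f : U * V -> W) a b v :
  'D_v (fun y => f (a, y)) b = 'D_(0, v) f (a, b).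
Proof.
rewrite /derive; set d := fun _ : R => _; set d' := fun _ : R => _.
suff -> : d = d' by []; apply/funext => h; rewrite /d /d' /=.
have -> : h *: (0, v) + (a, b) = (a, h *: v + b) :> U * V.
  by apply: injective_projections; rewrite //= scaler0 add0r.
by [].
Qed.

End PartialDerivatives.

Section ComplexValuedMaps.
Context {R : realType} {W : normedModType R}.
Implicit Types (f g : W -> R[i]) (x u : W).

(** Componentwise, to match [derC]. *)
Definition cdifferentiable f x : Prop :=
  differentiable (fun w => complex.Re (f w)) x /\
  differentiable (fun w => complex.Im (f w)) x.

Lemma ReM (a b : R[i]) : complex.Re (a * b) =
  complex.Re a * complex.Re b - complex.Im a * complex.Im b.
Proof. by case: a b => ? ? [? ?]. Qed.

Lemma ImM (a b : R[i]) : complex.Im (a * b) =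
  complex.Re a * complex.Im b + complex.Im a * complex.Re b.
Proof. by case: a b => ? ? [? ?]. Qed.

Lemma cdifferentiable_cst (a : R[i]) x : cdifferentiable (fun=> a) x.
Proof. by split; exact: differentiable_cst. Qed.

Lemma cdifferentiableD f g x : cdifferentiable f x -> cdifferentiable g x ->
  cdifferentiable (fun w => f w + g w) x.
Proof.
move=> [fr fi] [gr gi]; split.
  under eq_fun do rewrite raddfD; exact: differentiableD.
under eq_fun do rewrite raddfD; exact: differentiableD.
Qed.

Lemma cdifferentiableM f g x : cdifferentiable f x -> cdifferentiable g x ->
  cdifferentiable (fun w => f w * g w) x.
Proof.
move=> [fr fi] [gr gi]; split.
  under eq_fun do rewrite ReM.
  by apply: differentiableB; exact: differentiableM.
under eq_fun do rewrite ImM.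
by apply: differentiableD; exact: differentiableM.
Qed.

Lemma cdifferentiable_det m (M : W -> 'M[R[i]]_m) x :
  (forall i j, cdifferentiable (fun w => M w i j) x) ->
  cdifferentiable (fun w => \det (M w)) x.
Proof.
move=> MC; rewrite /determinant; elim: (index_enum _) => [|s r IH].
  under eq_fun do rewrite big_nil; exact: cdifferentiable_cst.
under eq_fun do rewrite big_cons; apply: cdifferentiableD IH.
apply: cdifferentiableM; first exact: cdifferentiable_cst.
elim: (index_enum _) => [|i r' IH].
  under eq_fun do rewrite big_nil; exact: cdifferentiable_cst.
by under eq_fun do rewrite big_cons; exact: cdifferentiableM.
Qed.

Lemma derC_mulr f (a : R[i]) u x : cdifferentiable f x ->
  derC u (fun w => f w * a) x = derC u f x * a.
Proof.
move=> [fr fi]; rewrite /derC.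
have Dr : derivable (fun w => complex.Re (f w)) x u by exact: diff_derivable.
have Di : derivable (fun w => complex.Im (f w)) x u by exact: diff_derivable.
rewrite (funext (fun w => ReM (f w) a)) (funext (fun w => ImM (f w) a)).
have Dr' b : 'D_u (fun w => complex.Re (f w) * b) x =
    'D_u (fun w => complex.Re (f w)) x * b.
  by rewrite [RHS]mulrC -deriveMr.
have Di' b : 'D_u (fun w => complex.Im (f w) * b) x =
    'D_u (fun w => complex.Im (f w)) x * b.
  by rewrite [RHS]mulrC -deriveMr.
have Mr b : derivable (fun w => complex.Re (f w) * b) x u.
  by apply: derivableM => //; exact: derivable_cst.
have Mi b : derivable (fun w => complex.Im (f w) * b) x u.
  by apply: derivableM => //; exact: derivable_cst.
have -> : 'D_u (fun w => complex.Re (f w) * complex.Re a -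
    complex.Im (f w) * complex.Im a) x =
    'D_u (fun w => complex.Re (f w)) x * complex.Re a -
    'D_u (fun w => complex.Im (f w)) x * complex.Im a.
  by rewrite deriveB// Dr' Di'.
have -> : 'D_u (fun w => complex.Re (f w) * complex.Im a +
    complex.Im (f w) * complex.Re a) x =
    'D_u (fun w => complex.Re (f w)) x * complex.Im a +
    'D_u (fun w => complex.Im (f w)) x * complex.Re a.
  by rewrite deriveD// Dr' Di'.
by case: a {Mr Mi}. 
Qed.

End ComplexValuedMaps.

Section ComplexDeterminant.
Context {R : realType} {N : nat}.
Notation V := (Cspace R N).

(** Only the images of the basis under [h] enter, and the complex linear [f] is then applied to
    them. These images are rows, so composition reverses the matrix product; hence the initial
    [mulrC]. *)
Lemma detC_comp (f h : V -> V) : linear f ->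
  (forall u, f (Jmul u) = Jmul (f u)) ->
  detC (f \o h) = detC f * detC h.
Proof.
move=> fL fJ; rewrite mulrC /detC -det_mulmx; congr (\det _).
pose F : {linear V -> V} := HB.pack f (GRing.isLinear.Build _ _ _ _ _ fL).
apply/matrixP => j l; rewrite !mxE /=.
have -> : h (cbasis j) = \sum_m ((h (cbasis j)).1 0 m *: cbasis m +
    (h (cbasis j)).2 0 m *: Jmul (cbasis m)).
  apply: injective_projections; rewrite !raddf_sum/=.
    rewrite [LHS]row_sum_delta; apply: eq_bigr => m _.
    by rewrite oppr0 scaler0 addr0.
  rewrite [LHS]row_sum_delta; apply: eq_bigr => m _.
  by rewrite scaler0 add0r.
have fD : {morph f : u v / u + v >-> u + v} := linearD F.
have fZ (b : R) u : f (b *: u) = b *: f u .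
  exact: (linearZ_LR F).
rewrite (big_morph f fD (linear0 F)).
under eq_bigr => m _ do rewrite fD !fZ fJ.
under [RHS]eq_bigr => m _ do rewrite !mxE.
apply/eqP; rewrite eq_complex; apply/andP; split; apply/eqP.
  rewrite !raddf_sum/= summxE; apply: eq_bigr => m _.
  by rewrite !mxE mulrN.
rewrite !raddf_sum/= summxE; apply: eq_bigr => m _.
by rewrite !mxE.
Qed.

End ComplexDeterminant.

(** * The action on the anticanonical bundle *)

Section Action.
Context {R : realType} {n N : nat} {G : topGroupType} {X : topologicalType}.
Notation V := (Cspace R N).
Variables (GM : manifold G 'rV[R]_n) (XM : manifold X V).
Variables (act : G -> X -> X) (K : set G) (x0 : X).
Hypothesis chs : is_complex_homogeneous_space GM XM act K x0.

Let act1 := chs_act1 chs.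
Let actM := chs_actM chs.

Lemma act_continuous g : continuous (act g).
Proof.
move=> x; have gx : (g, y) @[y --> x] --> (g, x).
  by apply: cvg_pair; [exact: cvg_cst|exact: cvg_id].
exact: (cvg_comp _ _ gx ((chs_smooth chs).1 (g, x))).
Qed.

Lemma act_continuous_l x : continuous (fun g => act g x).
Proof.
move=> g; have gx : (h, x) @[h --> g] --> (g, x).
  by apply: cvg_pair; [exact: cvg_id|exact: cvg_cst].
exact: (cvg_comp _ _ gx ((chs_smooth chs).1 (g, x))).
Qed.

Lemma act_differentiable c d g x : atlas XM c -> atlas XM d ->
  dom c x -> dom d (act g x) -> differentiable (d \o act g \o param c) (c x).
Proof.
move=> cA dA dx dgx; pose e := chart_at GM g.
have eA : atlas GM e := chart_at_atlas GM g.
have eg : dom e g := chart_at_dom GM g.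
have act_e := Cn_differentiable
  (smooth_map2_Cn 1 (chs_smooth chs) eA cA dA eg dx dgx).
have -> : d \o act g \o param c =
    (fun z => d (act (param e z.1) (param c z.2))) \o (fun z => (e g, z)).
  by apply/funext => z /=; rewrite (chartK eA eg).
by apply: differentiable_comp act_e; apply: differentiable_pair.
Qed.

(** The charts are left arbitrary so that the same chain rule covers tangent maps, read in preferred
    charts, and the fibre coordinate, where source and target share one chart. *)
Lemma derive_actM c d f g h x u :
  atlas XM c -> atlas XM d -> atlas XM f ->
  dom c x -> dom d (act h x) -> dom f (act g (act h x)) ->
  'D_u (f \o act (g * h)%g \o param c) (c x) =
  'D_('D_u (d \o act h \o param c) (c x)) (f \o act g \o param d)
    (d (act h x)).
Proof.
move=> cA dA fA dx dhx dghx.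
have cK : param c (c x) = x := chartK cA dx.
have dh := act_differentiable cA dA dx dhx.
have dg := act_differentiable dA fA dhx dghx.
have e : d (act h x) = (d \o act h \o param c) (c x) by rewrite /= cK.
set F := f \o act g \o param d in dg *.
have dg' : differentiable F ((d \o act h \o param c) (c x)) by rewrite -e.
rewrite (congr1 (derive F ^~ _) e) -(derive_comp u dh dg').
apply: near_eq_derive.
have pc := param_continuous cA dx.
rewrite /prop_for /continuous_at cK in pc.
near=> z; rewrite /F /= (chartK dA) ?actM//; near: z.
exact: (pc _ (act_continuous (near_dom dA dhx))).
Unshelve. all: by end_near. Qed.

Lemma tmap_actM g h x u :
  tmap XM XM (act (g * h)%g) x u =
  tmap XM XM (act g) (act h x) (tmap XM XM (act h) x u).
Proof.
rewrite /tmap actM.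
by apply: derive_actM; do ?[exact: chart_at_atlas|exact: chart_at_dom].
Qed.

Lemma linear_derive {U W : normedModType R} (f : U -> W) x :
  differentiable f x -> linear (fun u => 'D_u f x).
Proof. by move=> df a u v; rewrite !deriveE// linearP. Qed.

Lemma tmap_act_linear g x : linear (tmap XM XM (act g) x).
Proof.
apply: linear_derive.
by apply: act_differentiable; do ?[exact: chart_at_atlas|exact: chart_at_dom].
Qed.

(** As [h] fixes [x0], both tangent maps start at [x0]; the chain rule and the complex linearity of
    the action of [g] give a product of determinants. *)
Lemma isotropy_characterM g h : act h x0 = x0 ->
  isotropy_character XM act x0 (g * h)%g =
  isotropy_character XM act x0 g * isotropy_character XM act x0 h.
Proof.
move=> hx0; pose T g := tmap XM XM (act g) x0.
have TM : T (g * h)%g = T g \o T h.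
  by apply/funext => u; rewrite /T tmap_actM hx0.
rewrite /isotropy_character -/(T _) -/(T g) -/(T h) TM.
exact: detC_comp (tmap_act_linear g x0) (chs_holomorphic chs g x0).
Qed.

(* The action on the fibre coordinate of L_X, read in the single chart at the
   base point. *)
Lemma frame_coord_act g x s : dom (chart_at XM x) (act g x) ->
  frame_coord XM (chart_at XM x) (act_L XM act g (x, s)) =
  detC (fun u => 'D_u (chart_at XM x \o act g \o param (chart_at XM x))
                   (chart_at XM x x)) * s.
Proof.
move=> gx; set c := chart_at XM x in gx *; pose d := chart_at XM (act g x).
have cA : atlas XM c := chart_at_atlas XM x.
have dA : atlas XM d := chart_at_atlas XM (act g x).
have cx : dom c x := chart_at_dom XM x.
have dx : dom d (act g x) := chart_at_dom XM (act g x).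
(* Written as the action of 1, a change of charts falls under the lemmas on the action. *)
have c1 : c \o param d = c \o act 1%g \o param d.
  by apply/funext => z /=; rewrite act1.
have gx1 : dom c (act 1%g (act g x)) by rewrite act1.
pose T u := 'D_u (c \o param d) (d (act g x)).
have TL : linear T.
  by apply: linear_derive; rewrite c1; exact: act_differentiable.
have TJ u : T (Jmul u) = Jmul (T u).
  by apply: (chs_complex chs dA cA); exists (act g x).
have -> : (fun u => 'D_u (c \o act g \o param c) (c x)) =
    T \o tmap XM XM (act g) x.
  apply/funext => u; rewrite /T c1 -[in LHS](mul1g g).
  exact: derive_actM.
by rewrite (detC_comp _ TL TJ) -mulrA.
Qed.

End Action.

(** * The moment map along the isotropy group *)

Section Moment.
Context {R : realType} {n N : nat} {G : topGroupType} {X : topologicalType}.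
Notation V := (Cspace R N).
Variables (GM : manifold G 'rV[R]_n) (XM : manifold X V).
Variables (act : G -> X -> X) (K : set G) (x0 : X).
Hypothesis chs : is_complex_homogeneous_space GM XM act K x0.
Variable sigma : X -> V -> V -> R.

Let e := chart_at GM 1%g.
Let o := e 1%g.
Let c := chart_at XM x0.
Let eA : atlas GM e := chart_at_atlas GM 1%g.
Let e1 : dom e 1%g := chart_at_dom GM 1%g.
Let cA : atlas XM c := chart_at_atlas XM x0.
Let cx0 : dom c x0 := chart_at_dom XM x0.

(* An extension of the isotropy character to a neighbourhood of 1, in
   coordinates. *)
Definition isotropy_chart (z : 'rV[R]_n) : R[i] :=
  detC (fun u => 'D_u (c \o act (param e z) \o param c) (c x0)).

Lemma isotropy_chartE g : dom e g -> act g x0 = x0 ->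
  isotropy_chart (e g) = isotropy_character XM act x0 g.
Proof.
move=> eg gx0.
by rewrite /isotropy_chart /isotropy_character /tmap gx0 (chartK eA eg).
Qed.

Lemma cdifferentiable_isotropy_chart : cdifferentiable isotropy_chart o.
Proof.
pose F (z : 'rV[R]_n * V) := c (act (param e z.1) (param c z.2)).
have dc : dom c (act 1%g x0) by rewrite (chs_act1 chs).
(* Order 2: one derivative is spent on the tangent map along X, the other on its dependence on the
   group element. *)
have [_ DF] := smooth_map2_Cn 2 (chs_smooth chs) eA cA cA e1 cx0 dc.
have dF u :
    differentiable (fun z => 'D_u (c \o act (param e z) \o param c) (c x0)) o.
  have -> : (fun z => 'D_u (c \o act (param e z) \o param c) (c x0)) =
      (fun z => 'D_(0, u) F z) \o (fun z => (z, c x0)).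
    by apply/funext => z /=; rewrite -derive_snd.
  have dFu : differentiable (fun z => 'D_(0, u) F z) (o, c x0).
    have CF : Cn 1 (fun z => 'D_(0, u) F z) (o, c x0) := DF (0, u).
    exact: Cn_differentiable CF.
  by apply: differentiable_comp dFu; apply: differentiable_pair.
apply: cdifferentiable_det => j l.
have d1 (w : V) : differentiable (fun v : V => v.1) w.
  by apply: linear_differentiable => v; exact: cvg_fst.
have d2 (w : V) : differentiable (fun v : V => v.2) w.
  by apply: linear_differentiable => v; exact: cvg_snd.
split; under eq_fun do rewrite mxE /=.
  exact: differentiable_comp (differentiable_comp (dF (cbasis j)) (d1 _))
    (differentiable_coord _ _ _).
exact: differentiable_comp (differentiable_comp (dF (cbasis j)) (d2 _))
  (differentiable_coord _ _ _).
Qed.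

Lemma derC_frame_coord_act xi s :
  derC xi (fun z => frame_coord XM c (act_L XM act (param e z) (x0, s))) o =
  derC xi isotropy_chart o * s.
Proof.
rewrite -derC_mulr; last exact: cdifferentiable_isotropy_chart.
have pe := param_continuous eA e1.
rewrite /prop_for /continuous_at (chartK eA e1) in pe.
have near_c : \forall z \near o, dom c (act (param e z) x0).
  apply: (pe _ (act_continuous_l chs _)).
  by apply: (near_dom cA); rewrite (chs_act1 chs).
have fE : \forall z \near o,
    frame_coord XM c (act_L XM act (param e z) (x0, s)) = isotropy_chart z * s.
  by apply: filterS near_c => z; exact: frame_coord_act chs _ _ _.
by rewrite /derC; congr (_ +i* _); apply: near_eq_derive;
  apply: filterS fE => z ->.
Qed.

(** The moment map computation only divides by [s]. A point of the circle bundle has [s] nonzero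
    because its norm is 1, and the default value of [xget] has [s] equal to 1. *)
Lemma unit_overP x : exists2 s, s != 0 & unit_over XM sigma x = (x, s).
Proof.
rewrite /unit_over; case: xgetP => [[y s] _ [ys /= <-]|_].
  exists s => //; apply/eqP => s0; move: ys; rewrite /circle_bundle /= s0 /=.
  by rewrite !expr0n/= addr0 mul0r => /esym/eqP; rewrite oner_eq0.
by exists 1 => //; exact: oner_neq0.
Qed.

Lemma chern_form0 d z : chern_form XM sigma d z 0 = 0.
Proof.
have J0 : Jmul (0 : V) = 0 by rewrite /Jmul /= oppr0.
by rewrite /chern_form J0 !derive0 mul0r oppr0.
Qed.

Section Stabilizer.
Variables (p : R -> G) (t : R).
Hypotheses (ps : smooth_into GM p) (pt : p t = 1%g).
Hypothesis p_stab : \forall s \near t, act (p s) x0 = x0.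

Let xi := velocity GM p t.

Let ep : {for t, continuous p} := ps.1 t.

Let near_e : \forall s \near t, dom e (p s).
Proof. by apply: (ep (near_dom eA _)); rewrite pt. Qed.

Let dp : differentiable (e \o p) t.
Proof.
have [_ /(_ e t 1%N eA)] := (smooth_intoP _ _).1 ps.
by rewrite pt => /(_ e1) /Cn_differentiable.
Qed.

Let xiE : xi = 'D_1 (e \o p) t.
Proof. by rewrite /xi /velocity derive1E pt. Qed.

(** The orbit of [x0] along [p] is constant near [t], so the orbit map has zero derivative in the
    direction [xi]. The path will be s |-> p(s) p(t)^-1, whose velocity at t is the logarithmic
    velocity. *)
Lemma generated_field_stabilizer :
  tmap GM XM (fun g => act g x0) 1%g xi = 0.
Proof.
rewrite /tmap (chs_act1 chs) -/e -/c.
have dF : differentiable (c \o act ^~ x0 \o param e) ((e \o p) t).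
  have dc : dom c (act 1%g x0) by rewrite (chs_act1 chs).
  have act_e := Cn_differentiable
    (smooth_map2_Cn 1 (chs_smooth chs) eA cA cA e1 cx0 dc).
  have -> : c \o act ^~ x0 \o param e =
    (fun z => c (act (param e z.1) (param c z.2))) \o (fun z => (z, c x0)).
    by apply/funext => z /=; rewrite (chartK cA cx0).
  rewrite /= pt.
  by apply: differentiable_comp act_e; apply: differentiable_pair.
have -> : e 1%g = (e \o p) t by rewrite /= pt.
rewrite xiE -(derive_comp (1 : R) dp dF) -(derive_cst (c x0) t (1 : R)).
apply: near_eq_derive; near=> s.
rewrite /= (chartK eA); first by congr (c _); near: s.
by near: s; exact: near_e.
Unshelve. all: by end_near. Qed.

(** The fibre coordinate [s] of the chosen unit vector multiplies the vertical field and is divided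
    out by the connection form. *)
Lemma moment_stabilizer :
  moment GM XM act sigma xi x0 =
  'D_xi (fun z => complex.Im (isotropy_chart z)) o.
Proof.
rewrite /moment; have [s s0 ->] := unit_overP x0.
rewrite /alpha_form /generated_field [(_, _).1]/= [(_, _).2]/=.
rewrite generated_field_stabilizer chern_form0 addr0 derC_frame_coord_act.
by rewrite mulfK.
Qed.

(** The character is 1 at [p t], so there its imaginary part has the same derivative as its
    argument. This is the form that [is_derive_angle] consumes. *)
Lemma is_derive_moment :
  is_derive t 1 (fun s => complex.Im (isotropy_character XM act x0 (p s)))
    (moment GM XM act sigma xi x0).
Proof.
have [_ dI] := cdifferentiable_isotropy_chart.
have dI' : differentiable (fun z => complex.Im (isotropy_chart z)) ((e \o p) t).
  by rewrite /= pt.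
have -> : moment GM XM act sigma xi x0 =
    'D_1 ((fun z => complex.Im (isotropy_chart z)) \o (e \o p)) t.
  by rewrite moment_stabilizer (derive_comp (1 : R) dp dI') -xiE /= pt.
have E : \forall s \near t,
    ((fun z => complex.Im (isotropy_chart z)) \o (e \o p)) s =
    complex.Im (isotropy_character XM act x0 (p s)).
  near=> s; rewrite /= isotropy_chartE//; first by near: s; exact: near_e.
  by near: s.
apply: (near_eq_is_derive E); apply: derivableP; apply: diff_derivable.
exact: differentiable_comp.
Unshelve. all: by end_near. Qed.

End Stabilizer.

End Moment.

(** * Integrating the angle *)

Section FundamentalTheorem.
Context {R : realType}.
Notation mu := (@lebesgue_measure R).

Lemma Rintegral_derivative (a b : R) (F m f : R -> R) : a < b ->
  {within `[a, b], continuous F} -> continuous f ->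
  (forall t, a < t < b -> is_derive t 1 F (m t)) ->
  (forall t, a < t < b -> m t = f t) ->
  \int[mu]_(t in `[a, b]) m t = F b - F a.
Proof.
move=> ab /(continuous_within_itvP _ ab)[_ Fa Fb] fc dF mf.
have mfE : {in `]a, b[%classic, m =1 f}.
  by move=> t /set_mem/=; rewrite in_itv/= => /mf.
have emfE : {in `]a, b[%classic, EFin \o m =1 EFin \o f}.
  by move=> t /mfE /= ->.
have fmeas : measurable_fun (`]a, b[ : set R) (fun t => (f t)%:E).
  apply/measurable_EFinP.
  exact: measurable_funS (continuous_measurable_fun fc).
have mmeas : measurable_fun (`]a, b[ : set R) (fun t => (m t)%:E).
  by apply: eq_measurable_fun fmeas => t /emfE.
rewrite /Rintegral (integral_itv_bndoo true false mmeas).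
have -> : (\int[mu]_(t in `]a, b[) (m t)%:E =
    \int[mu]_(t in `]a, b[) (f t)%:E)%E.
  exact: eq_integral.
rewrite -(integral_itv_bndoo true false fmeas).
rewrite (@continuous_FTC2 _ f F)//.
- exact: continuous_subspaceT.
- by split=> // t; rewrite in_itv/= => /dF[].
- move=> t; rewrite in_itv/= => tab; rewrite derive1E -mf//.
  by have [_ ->] := dF t tab.
Qed.

End FundamentalTheorem.

Section Angle.
Context {R : realType}.

(* The local inverse [asin] of [sin] recovers the angle from the sine. *)
Lemma is_derive_angle (F g : R -> R) t m : {for t, continuous F} ->
  (\forall s \near t, g s = sin (F s - F t)) -> is_derive t 1 g m ->
  is_derive t 1 F m.
Proof.
move=> Fc gE dg.
have gt : g t = 0 by rewrite (nbhs_singleton gE) subrr sin0.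
have FE : \forall s \near t, F t + asin (g s) = F s.
  have pi2 : 0 < pi / 2 :> R by rewrite divr_gt0// pi_gt0.
  have Fclose := (cvgrPdist_lt _ _).1 Fc _ pi2.
  near=> s.
  have -> : g s = sin (F s - F t) by near: s.
  rewrite sinK ?subrKC//.
  have : `|F t - F s| < pi / 2 by near: s; exact: Fclose.
  rewrite ltr_norml in_itv/= => /andP[s1 s2].
  by apply/andP; split; lra.
apply: (near_eq_is_derive FE).
(* [g] vanishes at [t], and [asin] has slope 1 at 0, so [F] and [g] have the same derivative. *)
have da : is_derive (g t) 1 (@asin R) 1.
  rewrite gt; have := @is_derive1_asin R 0; rewrite ltrN10 ltr01 => /(_ isT).
  by rewrite expr0n/= subr0 sqrtr1 invr1.
have := is_derive1_comp da dg; rewrite mul1r => dag.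
rewrite -[m]add0r; exact: is_deriveD.
Unshelve. all: by end_near. Qed.

End Angle.

Section LogVelocity.
Context {R : realType} {n : nat} {G : topGroupType}.
Variable GM : manifold G 'rV[R]_n.
Hypothesis lieG : is_lie_group GM.

Lemma smooth_into_div {W : normedModType R} (p q : W -> G) :
  smooth_into GM p -> smooth_into GM q ->
  smooth_into GM (fun w => (p w * (q w)^-1)%g).
Proof.
move=> ps qs; apply: smooth_into_map2 lieG.1 ps _;
  try exact: has_coordinates_rV.
by apply: smooth_into_map lieG.2 qs; exact: has_coordinates_rV.
Qed.

(** The quotient p(a) p(b)^-1 is 1 on the diagonal, so a single chart, the one at 1, serves for all
    times. The logarithmic velocity is a partial derivative of this smooth map of two variables,
    restricted to the diagonal. *)
Lemma log_velocity_continuous (p : R -> G) : smooth_into GM p ->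
  continuous (log_velocity GM p).
Proof.
move=> ps t; pose q (z : R * R) := (p z.1 * (p z.2)^-1)%g.
have qs : smooth_into GM q.
  have Rc : has_coordinates R by exact: has_coordinates_R.
  exact: smooth_into_div (smooth_into_comp Rc (@Cn_fst R R R) ps)
    (smooth_into_comp Rc (@Cn_snd R R R) ps).
have [_ qC] := (smooth_intoP _ _).1 qs.
pose e := chart_at GM 1%g.
have qtt s : q (s, s) = 1%g by rewrite /q mulgV.
have : Cn 1 (e \o q) (t, t).
  by apply: qC; [exact: chart_at_atlas|rewrite qtt; exact: chart_at_dom].
move=> [_ /(_ (1, 0)) /nbhs_singleton cD].
have -> : log_velocity GM p =
    (fun z => 'D_(1, 0) (e \o q) z) \o (fun s => (s, s)).
  apply/funext => s; rewrite /log_velocity /velocity mulgV derive1E /=.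
  by rewrite -derive_fst.
have diag : (s, s) @[s --> t] --> (t, t).
  have tt : s @[s --> t] --> t by exact: cvg_id.
  exact: (cvg_pair tt tt).
exact: (cvg_comp _ _ diag cD).
Qed.

End LogVelocity.

(** * The value on paths in the isotropy group *)

Lemma is_subgroup_analytic {R : realType} {n : nat} {G : topGroupType}
    (GM : manifold G 'rV[R]_n) (h : {vspace 'rV[R]_n}) :
  is_subgroup (analytic_subgroup GM h).
Proof.
split.
- by move=> H [].
- move=> a b aH bH H HG Hexp; have [_ + _] := HG.
  by apply; [exact: aH|exact: bH].
- by move=> a aH H HG Hexp; have [_ _] := HG; apply; exact: aH.
Qed.

Section Lift.
Context {R : realType} {n : nat} {G : topGroupType}.
Variable GM : manifold G 'rV[R]_n.
Hypothesis lieG : is_lie_group GM.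
Variables (K : set G) (v : G -> R[i]) (vt : set (R -> G) -> R).
Hypotheses (subK : is_subgroup K) (lift : is_lift GM K v vt).

Lemma lift1 : vt (path_class GM K (fun=> 1%g)) = 0.
Proof.
have s1 := smooth_path1 GM subK.
have := lift_mul lift (ucover_class s1) (ucover_class s1).
rewrite ucover_mulE//; under eq_fun do rewrite mulg1.
by move=> /eqP; rewrite -subr_eq0 opprD addNKr oppr_eq0 => /eqP.
Qed.

Lemma lift_expn p k : smooth_path GM K p ->
  vt (path_class GM K (fun t => (p t ^+ k)%g)) = vt (path_class GM K p) *+ k.
Proof.
move=> ps; elim: k => [|k IH].
  by under eq_fun do rewrite expg0; rewrite lift1.
under eq_fun do rewrite expgS.
have pks := smooth_path_exp lieG subK k ps.
rewrite -ucover_mulE// (lift_mul lift) ?IH ?mulrS//; exact: ucover_class.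
Qed.

Lemma smooth_path_scale p t : smooth_path GM K p -> unit_itv t ->
  smooth_path GM K (fun s => p (t * s)).
Proof.
move=> [ps p0 pK] /andP[t0 t1]; split.
- have Rc : has_coordinates R by exact: has_coordinates_R.
  exact: (smooth_into_comp Rc (Cn_scale t) ps).
- by rewrite mulr0.
- move=> s /andP[s0 s1]; apply: pK.
  by rewrite /unit_itv/= mulr_ge0//= mulr_ile1.
Qed.

End Lift.

Section Computation.
Context {R : realType} {n N : nat} {G : topGroupType} {X : topologicalType}.
Notation V := (Cspace R N).
Variables (GM : manifold G 'rV[R]_n) (XM : manifold X V).
Hypothesis lieG : is_lie_group GM.
Variables (act : G -> X -> X) (K : set G) (x0 : X).
Hypothesis subK : is_subgroup K.
Hypothesis chs : is_complex_homogeneous_space GM XM act K x0.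
Variables (sigma : X -> V -> V -> R) (vt : set (R -> G) -> R).
Hypothesis lift : is_lift GM K (isotropy_character XM act x0) vt.

Lemma integral_moment p : smooth_path GM K p ->
  \int[lebesgue_measure]_(t in `[0, 1])
    moment GM XM act sigma (log_velocity GM p t) (act (p t) x0) =
  vt (path_class GM K p).
Proof.
move=> pK; have [ps p0 pI] := pK.
(* The lifted angle accumulated up to time [t], from the initial piece of [p] rescaled to [0, 1]. *)
pose theta (t : R) := vt (path_class GM K (fun s => p (t * s))).
have theta0 : theta 0 = 0.
  rewrite /theta; under eq_fun do rewrite mul0r p0.
  exact: (lift1 lieG subK lift).
have theta1 : theta 1 = vt (path_class GM K p).
  by rewrite /theta; under eq_fun do rewrite mul1r.
have thetac : {within `[0, 1], continuous theta}.
  have <- : @unit_itv R = `[0, 1]%classic.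
    by apply/seteqP; split=> t; rewrite /unit_itv/= in_itv.
  exact: (lift_continuous lift pK).
have stab t : unit_itv t -> act (p t) x0 = x0.
  by move=> tI; apply/(chs_stabilizer chs); exact: pI.
have vE t : unit_itv t -> isotropy_character XM act x0 (p t) =
    cos (theta t) +i* sin (theta t).
  by move=> tI; have := lift_exp lift (smooth_path_scale pK tI); rewrite mulr1.
have sinE s t : unit_itv s -> unit_itv t ->
    complex.Im (isotropy_character XM act x0 (p s * (p t)^-1)%g) =
    sin (theta s - theta t).
  move=> sI tI; have := vE s sI.
  rewrite -{1}(mulgVK (p t) (p s)) (isotropy_characterM chs _ (stab t tI)) vE//.
  case: (isotropy_character _ _ _ _) => a b [cE sE].
  rewrite sinB -cE -sE /=.
  (* With a + i b the character of the quotient, [cE] and [sE] form a linear system for a and b of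
     determinant cos^2 + sin^2 = 1; it is solved for b. *)
  have cs := cos2Dsin2 (theta t).
  by rewrite -[LHS]mulr1 -cs; ring.
rewrite -theta1 -[RHS]subr0 -[X in _ = _ - X]theta0.
(* A continuous function on the whole line that agrees with the moment at interior times. *)
pose f t := 'D_(log_velocity GM p t)
  (fun z => complex.Im (isotropy_chart GM XM act x0 z)) (chart_at GM 1%g 1%g).
have [_ dI] := cdifferentiable_isotropy_chart chs.
(* Translating [p] to pass through 1 at time [t] makes its velocity there, by definition, the
   logarithmic velocity of [p]. *)
pose q t (s : R) := (p s * (p t)^-1)%g.
have qs t : smooth_into GM (q t).
  by apply: smooth_into_div => //; exact: smooth_into_cst.
have qt t : q t t = 1%g by rewrite /q mulgV.
have itv01 (t : R) : 0 < t < 1 -> unit_itv t.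
  by rewrite /unit_itv/= => /andP[/ltW-> /ltW->].
(* Differentiating at [t] needs the path in the isotropy group on both sides of [t], which is
   granted at interior times. *)
have near01 (t : R) : 0 < t < 1 -> \forall s \near t, unit_itv s.
  move=> t01; have : t \in `]0, 1[ by rewrite in_itv.
  by move=> /near_in_itvoo; apply: filterS => s; rewrite in_itv => /itv01.
have q_stab (t : R) : 0 < t < 1 -> \forall s \near t, act (q t s) x0 = x0.
  move=> t01; apply: filterS (near01 t t01) => s sI.
  rewrite /q (chs_actM chs); have tI := itv01 t t01.
  have -> : act (p t)^-1%g x0 = x0.
    by rewrite -{1}(stab t tI) -(chs_actM chs) mulVg (chs_act1 chs).
  exact: stab.
apply: (Rintegral_derivative (F := theta) (f := f)) => //.
- move=> t.
  have -> : f = ('d (fun z => complex.Im (isotropy_chart GM XM act x0 z))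
      (chart_at GM 1%g 1%g)) \o log_velocity GM p.
    by apply/funext => s; rewrite /f deriveE.
  apply: continuous_comp; first exact: log_velocity_continuous.
  exact: diff_continuous.
- move=> t t01; rewrite stab; last exact: itv01.
  have thetat : {for t, continuous theta}.
    have [+ _ _] := (continuous_within_itvP _ ltr01).1 thetac.
    by apply; rewrite in_itv.
  apply: is_derive_angle thetat _
    (is_derive_moment chs sigma (qs t) (qt t) (q_stab t t01)).
  by apply: filterS (near01 t t01) => s sI; apply: sinE => //; exact: itv01.
- move=> t t01; rewrite stab; last exact: itv01.
  exact: (moment_stabilizer chs sigma (qs t) (qt t) (q_stab t t01)).
Qed.

Hypothesis sigmaK : is_kahler_form XM sigma.

Lemma kahler0l x w : sigma x 0 w = 0.
Proof.
have := kahler_linear sigmaK x (-1) 0 0 w.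
by rewrite scaler0 add0r mulN1r addNr.
Qed.

Lemma is_filling_disk_cst p : smooth_path GM K p ->
  is_filling_disk XM act sigma (fun=> x0) p x0.
Proof.
move=> [_ _ pI].
have stab t : unit_itv t -> x0 = act (p t) x0.
  by move=> tI; apply/esym/(chs_stabilizer chs); exact: pI.
split=> //; first exact: smooth_into_cst.
  by move=> s sI; split=> //; apply: stab; exact: unit_itv1.
have metric0 c z w : metric_in XM sigma c z 0 w = 0.
  by rewrite /metric_in /form_in derive0 kahler0l.
move=> t w _ /=; under eq_fun do rewrite derive1_cst metric0.
rewrite derive1_cst.
have -> : (fun z => metric_in XM sigma (chart_at XM x0) z
    (derive1 (fun=> chart_at XM x0 x0) t)
    (derive1 (fun=> chart_at XM x0 x0) t)) = cst 0.
  by apply/funext => z; rewrite derive1_cst metric0.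
by rewrite derive_cst mul0r.
Qed.

Lemma square_area_cst : square_area XM sigma (fun=> x0) = 0.
Proof.
rewrite /square_area /velocity.
have E (s t : R) : sigma x0 (derive1 (fun=> chart_at XM x0 x0) t)
    (derive1 (fun=> chart_at XM x0 x0) s) = 0.
  by rewrite derive1_cst kahler0l.
under eq_Rintegral do under eq_Rintegral do rewrite E.
have int0 : \int[lebesgue_measure]_(t in `[0, 1]%classic) (0 : R) = 0.
  by rewrite /Rintegral integral0.
by under eq_Rintegral do rewrite int0; exact: int0.
Qed.

Lemma nu_path p nu : is_nu GM XM act sigma nu -> smooth_path GM K p ->
  nu x0 (path_class GM setT p) = - vt (path_class GM K p).
Proof.
move=> nuE pK.
rewrite (nuE x0 p (fun=> x0) (smooth_pathT pK) (is_filling_disk_cst pK)).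
by rewrite square_area_cst sub0r integral_moment.
Qed.

(** Powers of [p] stay in [K], where [nu x0] is minus the additive lift; the homogenizing sequence
    is thus constant from k = 1 on. *)
Lemma nuG_path p nu nuG : is_nu GM XM act sigma nu -> is_nuG GM nu nuG ->
  smooth_path GM K p ->
  nuG (path_class GM setT p) = - vt (path_class GM K p).
Proof.
move=> nuE nuGE pK; have pT := smooth_pathT pK.
have lim := nuGE x0 _ (ucover_class pT).
rewrite -(cvg_lim _ lim)//; apply: lim_near_cst => //; near=> k.
have k0 : (0 < k)%N by near: k; exact: nbhs_infty_gt.
rewrite ucover_expE// (nu_path nuE); last exact: smooth_path_exp.
rewrite (lift_expn lieG subK lift)// -[vt _ *+ k]mulr_natr mulNr mulfK//.
by rewrite pnatr_eq0 -lt0n.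
Unshelve. all: by end_near. Qed.

End Computation.

Theorem proposition1p3 (R : realType) (n N : nat)
  (G : topGroupType) (GM : manifold G 'rV[R]_n)
  (X : topologicalType) (XM : manifold X (Cspace R N))
  (act : G -> X -> X) (x0 : X)
  (k : {vspace 'rV[R]_n}) (sigma : X -> Cspace R N -> Cspace R N -> R)
  (nu : X -> set (R -> G) -> R) (nuG vt rho : set (R -> G) -> R) :
  connected_simple_lie_group GM ->
  ~ compact [set: G] ->
  maximal_compact_subalgebra GM k ->
  is_complex_homogeneous_space GM XM act (analytic_subgroup GM k) x0 ->
  is_bergman_form XM act sigma ->
  is_nu GM XM act sigma nu ->
  (forall x, quasimorphism GM (nu x)) ->
  is_nuG GM nu nuG ->
  is_lift GM (analytic_subgroup GM k) (isotropy_character XM act x0) vt ->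
  is_guichardet_wigner GM (analytic_subgroup GM k) vt rho ->
  forall a, ucover GM [set: G] a -> nuG a = - rho a.
Proof.
move=> [lieG _ _ _] _ _ chs [sigmaK _ _] nuE nuqm nuGE lift [_ rho_unique] a aU.
have subK := is_subgroup_analytic GM k.
have [[C nuGC] nuGX] := homogenization_quasimorphism lieG (nuqm x0) (nuGE x0).
(* [nuG] restricts to minus the lift, so the competitor compared with [rho] is [- nuG]; the sign
   change preserves both the defect bound and homogeneity. *)
rewrite -(rho_unique (fun b => - nuG b)) ?opprK//; split; first split.
- exists C => b c bU cU; have := nuGC b c bU cU.
  by rewrite -normrN !opprD !opprK.
- by move=> b m bU; rewrite nuGX// mulNrn.
- move=> _ [p pK ->]; rewrite ucover_mapE//.
  by rewrite (nuG_path lieG subK chs lift sigmaK nuE nuGE pK) opprK.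
Qed.
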